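(* Let $\alpha=(\alpha_1,\ldots,\alpha_m)\in\mathbb{R}_+^m$ be generic, $m\ge4$, and suppose $\alpha_m\ne\alpha_{m-1}$. Put $$\alpha^+:=(\alpha_1,\ldots,\alpha_{m-2},\alpha_{m-1}+\alpha_m),\qquad\alpha^-:=(\alpha_1,\ldots,\alpha_{m-2},|\alpha_{m-1}-\alpha_m|),$$ let $c_i=c_1(V_i(\alpha))$ for $1\le i\le m$ and $c_i^{\pm}=c_1(V_i(\alpha^{\pm}))$ for $1\le i\le m-1$. Let $i_\pm:D^{\pm}_{m-1,m}(\alpha)\hookrightarrow\mathcal{M}(\alpha)$ be the inclusions and $s_\pm:D^{\pm}_{m-1,m}(\alpha)\to\mathcal{M}(\alpha^{\pm})$ the symplectomorphisms $[(\vec v_1,\ldots,\vec v_m)]\mapsto[(\vec v_1,\ldots,\vec v_{m-2},\vec v_{m-1}+\vec v_m)]$. Then $$(i_\pm\circ s_\pm^{-1})^*c_i=c_i^{\pm}\quad\text{for }1\le i\le m-2,$$ $$(i_+\circ s_+^{-1})^*c_{m-1}=c_{m-1}^+,\qquad(i_-\circ s_-^{-1})^*c_{m-1}=\operatorname{sgn}(\alpha_{m-1}-\alpha_m)\,c_{m-1}^-,$$ $$(i_+\circ s_+^{-1})^*c_m=c_{m-1}^+,\qquad(i_-\circ s_-^{-1})^*c_m=-\operatorname{sgn}(\alpha_{m-1}-\alpha_m)\,c_{m-1}^-.$$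
   Context: For $n\ge3$ and $\beta=(\beta_1,\ldots,\beta_n)\in\mathbb{R}_{+}^n$, let $S^2_{\beta_i}\subset\mathbb{R}^3$ be the sphere of radius $\beta_i$ centred at the origin. The polygon space is $$\mathcal{M}(\beta)=\Big\{(\vec v_1,\ldots,\vec v_n)\in\prod_{i=1}^n S^2_{\beta_i}\ \Big|\ \sum_{i=1}^n\vec v_i=0\Big\}\Big/SO(3),$$ with $SO(3)$ acting diagonally. $\beta$ is generic if $\sum_{i=1}^n\varepsilon_i\beta_i=0$ has no solution with all $\varepsilon_i=\pm1$. For generic $\beta$, $\mathcal{M}(\beta)$ is a compact (possibly empty) symplectic manifold of dimension $2(n-3)$: the symplectic quotient at $0$ of $\prod_i S^2_{\beta_i}$ with the form $\omega=\sum_i\beta_i\,\omega_{S^2}$ by the diagonal $SO(3)$-action with moment map $\vec v\mapsto\sum_i\vec v_i$; its symplectic form is also denoted $\omega$. Genericity of $\alpha$ implies that of $\alpha^{\pm}$ (when $\alpha_{m-1}\neq\alpha_m$). For $1\le j\le n$ let $V_j(\beta)=\{\vec v\in\prod_i S^2_{\beta_i}\mid\sum_i\vec v_i=0,\ \vec v_j=(0,0,\beta_j)\}$, on which $S^1$ acts freely by rotation about the $z$-axis with quotient $\mathcal{M}(\beta)$; $c_1(V_j(\beta))$ is the first Chern class of the principal circle bundle $V_j(\beta)\to\mathcal{M}(\beta)$, with the sign convention for which $c_1(V_j(\beta))=\frac{\partial}{\partial\beta_j}[\omega]$ in $H^2(\mathcal{M}(\beta);\mathbb{R})$ (with the usual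 factor $2\pi$ absorbed in the normalization of $[\omega]$; cohomologies of $\mathcal{M}(\beta')$ for $\beta'$ near $\beta$ are canonically identified). The identities may be read in $H^2(\,\cdot\,;\mathbb{R})$. $D_{m-1,m}(\alpha)\subset\mathcal{M}(\alpha)$ is the codimension-two submanifold of classes of polygons for which $\vec v_{m-1}$ and $\vec v_m$ are parallel (linearly dependent), and $D^{\pm}_{m-1,m}(\alpha)=\{[\vec v]\in D_{m-1,m}(\alpha)\mid\pm\langle\vec v_{m-1},\vec v_m\rangle>0\}$, with the restricted symplectic forms. $\operatorname{sgn}(x)=\pm1$ is the sign of $x\ne0$. *)

(* Defs.v *)
From HB Require Import structures.
From mathcomp Require Import all_boot all_order all_algebra.
From mathcomp Require Import all_classical all_reals all_analysis.

Set Implicit Arguments.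
Unset Strict Implicit.
Unset Printing Implicit Defensive.

Import Order.TTheory GRing.Theory Num.Theory numFieldNormedType.Exports.

Local Open Scope classical_set_scope.
Local Open Scope ring_scope.
Local Open Scope quotient_scope.

(* Cech cohomology H^2(X; Z). Following Godement, open covers are indexed by the points of X, with x in
   U x; these are cofinal among all covers, and two of them always have the
   common refinement x |-> U x `&` V x.  A p-cochain with values in a presheaf
   of A-valued functions is encoded by a total function c, of which only the
   values c s z for z in the overlap of the U (s i) are meaningful.  Passing to
   the direct limit over all covers then amounts to asking that a condition
   holds on the overlaps of some cover. *)

Notation cochain X A p := (('I_p.+1 -> X) -> X -> A).

Section Cech.
Context (X : topologicalType).

Definition open_cover (U : X -> set X) := forall x, open (U x) /\ U x x.

Definition overlap (U : X -> set X) p (s : 'I_p.+1 -> X) : set X :=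
  [set z | forall i, U (s i) z].

Definition delta (A : pzRingType) p (c : cochain X A p) : cochain X A p.+1 :=
  fun s z => \sum_(i < p.+2) (-1) ^+ i * c (s \o lift i) z.

Definition locally_constant_on (W : set X) (g : X -> int) :=
  forall z, W z -> \forall z' \near z, g z' = g z.

Definition is_cocycle (c : cochain X int 2) :=
  exists U, [/\ open_cover U,
    forall s, locally_constant_on (overlap U s) (c s) &
    forall s z, overlap U s z -> delta c s z = 0].

Definition is_coboundary (c : cochain X int 2) :=
  exists U, exists b : cochain X int 1, [/\ open_cover U,
    forall s, locally_constant_on (overlap U s) (b s) &
    forall s z, overlap U s z -> c s z = delta b s z].

Lemma open_coverT : open_cover (fun=> setT).
Proof. by move=> x; split => //; exact: openT. Qed.

Lemma open_coverI U V : open_cover U -> open_cover V ->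
  open_cover (fun x => U x `&` V x).
Proof.
by move=> hU hV x; have [? ?] := hU x; have [? ?] := hV x; split => //;
  exact: openI.
Qed.

Lemma overlapI U V p (s : 'I_p.+1 -> X) z :
  overlap (fun x => U x `&` V x) s z -> overlap U s z /\ overlap V s z.
Proof. by move=> h; split=> i; have [] := h i. Qed.

Lemma delta0 (A : pzRingType) p s z : delta (0 : cochain X A p) s z = 0.
Proof. by rewrite /delta big1// => i _; rewrite /= mulr0. Qed.

Lemma deltaB (A : pzRingType) p (c d : cochain X A p) s z :
  delta (c - d) s z = delta c s z - delta d s z.
Proof. by rewrite /delta -sumrB; apply: eq_bigr => i _; rewrite -mulrBr. Qed.

Lemma locally_constant_onB (W W1 W2 : set X) (g h : X -> int) :
  (forall z, W z -> W1 z /\ W2 z) ->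
  locally_constant_on W1 g -> locally_constant_on W2 h ->
  locally_constant_on W (g - h).
Proof.
move=> WI hg hh z /WI[/hg gz /hh hz].
by apply: filterS2 gz hz => z' gz hz; rewrite !fctE gz hz.
Qed.

Lemma locally_constant_on0 (W : set X) : locally_constant_on W 0.
Proof. by move=> z _; exact: nearW. Qed.

Definition cocycles : {pred cochain X int 2} := [pred c | `[< is_cocycle c >]].

Lemma cocycles_closed : zmod_closed cocycles.
Proof.
split.
  apply/asboolP; exists (fun=> setT); split; first exact: open_coverT.
    by move=> s; exact: locally_constant_on0.
  by move=> s z _; rewrite delta0.
move=> c d /asboolP[U [hU cU dU]] /asboolP[V [hV cV dV]].
apply/asboolP; exists (fun x => U x `&` V x); split.
- exact: open_coverI.
- by move=> s; apply: locally_constant_onB (cU s) (cV s) => z /overlapI.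
- by move=> s z /overlapI[Uz Vz]; rewrite deltaB dU// dV// subrr.
Qed.

HB.instance Definition _ :=
  GRing.isZmodClosed.Build (cochain X int 2) cocycles cocycles_closed.

Record cocycle := Cocycle { cocycle_val :> cochain X int 2;
                            cocycleP : cocycle_val \in cocycles }.
HB.instance Definition _ := [isSub for cocycle_val].
HB.instance Definition _ := [Choice of cocycle by <:].
HB.instance Definition _ := [SubChoice_isSubZmodule of cocycle by <:].

Definition coboundaries : {pred cocycle} := [pred c | `[< is_coboundary (val c) >]].

Lemma coboundaries_closed : zmod_closed coboundaries.
Proof.
split.
  apply/asboolP; exists (fun=> setT), 0; split; first exact: open_coverT.
    by move=> s; exact: locally_constant_on0.
  by move=> s z _; rewrite delta0.
move=> c d /asboolP[U [b [hU bU dU]]] /asboolP[V [b' [hV bV dV]]].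
apply/asboolP; exists (fun x => U x `&` V x), (b - b'); split.
- exact: open_coverI.
- by move=> s; apply: locally_constant_onB (bU s) (bV s) => z /overlapI.
- by move=> s z /overlapI[Uz Vz]; rewrite deltaB -dU// -dV.
Qed.

HB.instance Definition _ :=
  GRing.isZmodClosed.Build cocycle coboundaries coboundaries_closed.

Definition H2 := Quotient.quot coboundaries.

End Cech.

Section Pullback.
Context (X Y : topologicalType) (phi : continuousType X Y).

Definition cochain_pullback A p (c : cochain Y A p) : cochain X A p :=
  fun s z => c (phi \o s) (phi z).

Lemma open_cover_pullback U : open_cover U ->
  open_cover (fun x => phi @^-1` U (phi x)).
Proof.
move=> hU x; have [oU Ux] := hU (phi x); split => //.
by apply: open_comp => // z _; exact: cts_fun.
Qed.

Lemma locally_constant_on_pullback W (g : Y -> int) :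
  locally_constant_on W g -> locally_constant_on (phi @^-1` W) (g \o phi).
Proof. by move=> hg z /hg gz; exact: (@cts_fun _ _ phi z _ gz). Qed.

Lemma cocycle_pullback_subproof (c : cocycle Y) :
  cochain_pullback c \in @cocycles X.
Proof.
have /asboolP[U [hU cU dU]] := cocycleP c.
apply/asboolP; exists (fun x => phi @^-1` U (phi x)); split.
- exact: open_cover_pullback.
- move=> s; exact: (locally_constant_on_pullback (cU (phi \o s))).
- by move=> s z Uz; exact: (dU (phi \o s) (phi z)).
Qed.

Definition cocycle_pullback (c : cocycle Y) : cocycle X :=
  Cocycle (cocycle_pullback_subproof c).

Definition pullback (h : H2 Y) : H2 X :=
  \pi_(H2 X) (cocycle_pullback (repr h)).

Lemma pullback_pi (c : cocycle Y) :
  pullback (\pi_(H2 Y) c) = \pi_(H2 X) (cocycle_pullback c).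
Proof.
apply/eqP; rewrite /pullback -Quotient.idealrBE.
have : repr (\pi_(H2 Y) c) - c \in @coboundaries Y.
  by rewrite Quotient.idealrBE reprK.
move=> /asboolP[U [b [hU bU dU]]].
apply/asboolP; exists (fun x => phi @^-1` U (phi x)), (cochain_pullback b); split.
- exact: open_cover_pullback.
- move=> s; exact: (locally_constant_on_pullback (bU (phi \o s))).
- by move=> s z Uz; exact: (dU (phi \o s) (phi z)).
Qed.

End Pullback.

(* The first Chern class of a principal circle bundle pr : P -> X is the image
   of its transition functions under the connecting homomorphism of the
   exponential sequence 0 -> Z -> C(R) -> C(S^1) -> 0.  The circle is R / 2 pi Z
   and acts on P by act : R -> P -> P.  With local sections sigma x over U x,
   the transition functions are exp (2 pi i f), where
     sigma x = act (2 pi f_xy) (sigma y)  on  U x `&` U y,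
   and delta f is an integral cocycle representing the class.
   For a principal circle bundle over a compact manifold there is exactly one
   such class, so that the default value of [xget] plays no role.
   Sign: for the outward area forms on the spheres, this order of x and y makes
   the class of V_j equal to the derivative of the (normalized) class of the
   symplectic form in the direction of beta_j.  The other order would replace
   c_1 by - c_1 for all bundles at once. *)
Section Chern.
Context (R : realType) (X P : topologicalType).
Variables (act : R -> P -> P) (pr : P -> X).

Definition is_chern_class (h : H2 X) :=
  exists c : cocycle X, h = \pi_(H2 X) c /\
  exists U, exists (sigma : X -> X -> P) (f : cochain X R 1),
  [/\ open_cover U,
      forall x z, U x z -> pr (sigma x z) = z /\ {for z, continuous (sigma x)},
      forall s z, overlap U s z -> {for z, continuous (f s)},
      forall s z, overlap U s z ->
        sigma (s ord0) z = act (2 * pi * f s z) (sigma (s ord_max) z) &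
      forall s z, overlap U s z -> (val c s z)%:~R = delta f s z].

Definition chern_class : H2 X := xget 0 [set h | is_chern_class h].

End Chern.

Section Polygons.
Context (R : realType).

Definition dot (u v : 'rV[R]_3) : R := (u *m v^T) 0 0.

Definition enorm (u : 'rV[R]_3) : R := Num.sqrt (dot u u).

Definition SO3 : set 'M[R]_3 := [set g | g *m g^T = 1%:M /\ \det g = 1].

Definition ez : 'rV[R]_3 := delta_mx 0 ord_max.

(* Acts on row vectors from the right, counterclockwise about the z-axis. *)
Definition rotz (t : R) : 'M[R]_3 :=
  \matrix_(i, j) (nth [::] [:: [:: cos t; sin t; 0];
                              [:: - sin t; cos t; 0];
                              [:: 0; 0; 1]] i)`_j.

Lemma dot_orth (g : 'M[R]_3) u v :
  g *m g^T = 1%:M -> dot (u *m g) (v *m g) = dot u v.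
Proof.
by move=> gg; rewrite /dot trmx_mul mulmxA -(mulmxA u) gg mulmx1.
Qed.

Lemma rotz_orth t : rotz t *m (rotz t)^T = 1%:M.
Proof.
have cs := cos2Dsin2 t; apply/matrixP => i j.
rewrite !mxE !big_ord_recr big_ord0 /= !mxE /=.
case: i => -[|[|[|//]]] ?; case: j => -[|[|[|//]]] ? /=;
  rewrite ?(mulr0, mul0r, mulr1, add0r, addr0, mulrN, mulNr, opprK) -?expr2 //.
- by rewrite mulrC addNr.
- by rewrite mulrC addNr.
- by rewrite addrC.
Qed.

Lemma ez_rotz t : ez *m rotz t = ez.
Proof.
apply/rowP => j; rewrite !mxE !big_ord_recr big_ord0 /= !mxE /=.
by case: j => -[|[|[|//]]] ? /=; rewrite ?(mulr0, mul0r, mulr1, add0r, addr0).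
Qed.

Section PolygonSpace.
Context (n : nat) (beta : 'I_n -> R).

(* The polygons are the n x 3 matrices whose rows are the vectors v_i. *)
Definition closed_polygons : set 'M[R]_(n, 3) :=
  [set v | (forall i, enorm (row i v) = beta i) /\ \sum_i row i v = 0].

Lemma closed_polygons_orth (g : 'M[R]_3) v :
  g *m g^T = 1%:M -> closed_polygons v -> closed_polygons (v *m g).
Proof.
move=> gg [nv sv]; split.
  by move=> i; rewrite row_mul /enorm dot_orth; first exact: nv.
under eq_bigr do rewrite row_mul.
by rewrite -mulmx_suml sv mul0mx.
Qed.

Definition generic := forall e : 'I_n -> bool, \sum_i (-1) ^+ e i * beta i != 0.

Definition congruent (v w : closed_polygons) : bool :=
  `[< exists2 g, SO3 g & val w = val v *m g >].

Lemma congruent_refl : reflexive congruent.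
Proof.
move=> v; apply/asboolP; exists 1%:M; last by rewrite mulmx1.
by split; rewrite ?trmx1 ?mulmx1 ?det1.
Qed.

Lemma congruent_sym : symmetric congruent.
Proof.
have sub v w : congruent v w -> congruent w v.
  move=> /asboolP[g [gg dg] wE]; apply/asboolP; exists g^T.
    by split; rewrite ?trmxK ?det_tr//; exact: mulmx1C.
  by rewrite wE -mulmxA gg mulmx1.
by move=> v w; apply/idP/idP; exact: sub.
Qed.

Lemma congruent_trans : transitive congruent.
Proof.
move=> w v u /asboolP[g [gg dg] wE] /asboolP[h [hh dh] uE].
apply/asboolP; exists (g *m h); last by rewrite uE wE mulmxA.
split; last by rewrite det_mulmx dg dh mulr1.
by rewrite trmx_mul mulmxA -(mulmxA g) hh mulmx1.
Qed.

Canonical congruent_equiv :=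
  EquivRel congruent congruent_refl congruent_sym congruent_trans.

Definition polygon_space :=
  quotient_topology {eq_quot congruent_equiv}.

Definition polygon_class (v : closed_polygons) : polygon_space :=
  \pi_polygon_space v.

Lemma polygon_classP v w : polygon_class v = polygon_class w <->
  exists2 g, SO3 g & val w = val v *m g.
Proof.
split.
  by move=> vw; have /eqmodP/asboolP : v = w %[mod {eq_quot congruent_equiv}] by [].
by move=> vw; apply/eqmodP/asboolP.
Qed.

Definition Vset (j : 'I_n) : set 'M[R]_(n, 3) :=
  closed_polygons `&` [set v | row j v = beta j *: ez].

Lemma Vset_rotz j t v : Vset j v -> Vset j (v *m rotz t).
Proof.
move=> [Pv vj]; split; first exact/closed_polygons_orth/Pv/rotz_orth.
by rewrite /= row_mul vj -scalemxAl ez_rotz.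
Qed.

Definition V_rot j (t : R) (v : Vset j) : Vset j :=
  exist _ (val v *m rotz t) (mem_set (Vset_rotz t (set_valP v))).

Definition V_proj j (v : Vset j) : polygon_space :=
  polygon_class (exist _ (val v) (mem_set (set_valP v).1)).

Definition c1V (j : 'I_n) : H2 polygon_space :=
  chern_class (@V_rot j) (@V_proj j).

End PolygonSpace.
End Polygons.

(* A polygon with m = n.+2 edges has last two edges [penult n] and [ord_max];
   [lift ord_max : 'I_n.+1 -> 'I_n.+2] is the inclusion of the indices other
   than the last. *)

Variant pm := Plus | Minus.

Definition penult n : 'I_n.+2 := lift ord_max ord_max.

Section Gluing.
Context (R : realType) (n : nat) (alpha : 'I_n.+2 -> R).

Definition alpha_pm (e : pm) (j : 'I_n.+1) : R :=
  if j == ord_max then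
    match e with
    | Plus => alpha (penult n) + alpha ord_max
    | Minus => `|alpha (penult n) - alpha ord_max|
    end
  else alpha (lift ord_max j).

Definition has_sign (e : pm) (x : R) : bool :=
  match e with Plus => 0 < x | Minus => x < 0 end.

Definition collinear (e : pm) (v : 'M[R]_(n.+2, 3)) : Prop :=
  ~~ free [:: row (penult n) v; row ord_max v] /\
  has_sign e (dot (row (penult n) v) (row ord_max v)).

Definition Dsub (e : pm) : set (polygon_space alpha) :=
  [set @polygon_class _ _ alpha v | v in [set v | collinear e (val v)]].

Definition fuse_mx (v : 'M[R]_(n.+2, 3)) : 'M[R]_(n.+1, 3) :=
  \matrix_j if j == ord_max then row (penult n) v + row ord_max v
            else row (lift ord_max j) v.

Lemma dotZ (k : R) u w : dot (k *: u) w = k * dot u w.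
Proof. by rewrite /dot -scalemxAl mxE. Qed.

Lemma dotZr (k : R) u w : dot u (k *: w) = k * dot u w.
Proof. by rewrite /dot linearZ -scalemxAr mxE. Qed.

Lemma dotE (u : 'rV[R]_3) : dot u u = \sum_i u 0 i ^+ 2.
Proof. by rewrite /dot mxE; apply: eq_bigr => i _; rewrite mxE expr2. Qed.

Lemma dot_ge0 (u : 'rV[R]_3) : 0 <= dot u u.
Proof. by rewrite dotE; apply: sumr_ge0 => i _; exact: sqr_ge0. Qed.

Lemma dot_gt0 (u : 'rV[R]_3) : u != 0 -> 0 < dot u u.
Proof.
move=> u0; rewrite lt_neqAle dot_ge0 andbT eq_sym; apply: contra u0.
rewrite dotE psumr_eq0; last by move=> i _; exact: sqr_ge0.
move=> /allP u0; apply/eqP/rowP => i; rewrite mxE.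
by have := u0 i (mem_index_enum i); rewrite sqrf_eq0 => /eqP.
Qed.

Lemma enormZ (k : R) u : enorm (k *: u) = `|k| * enorm u.
Proof.
rewrite /enorm dotZ dotZr mulrA -expr2 sqrtrM ?sqr_ge0// sqrtr_sqr.
by [].
Qed.

Lemma enorm_ge0 (u : 'rV[R]_3) : 0 <= enorm u.
Proof. exact: sqrtr_ge0. Qed.

Lemma enorm_gt0 (u : 'rV[R]_3) : (0 < enorm u) = (u != 0).
Proof.
apply/idP/idP; last by move=> /dot_gt0; rewrite sqrtr_gt0.
apply: contraTneq => ->; rewrite /enorm /dot mul0mx mxE sqrtr0.
by rewrite ltxx.
Qed.

Lemma has_signM e k x : 0 < x -> has_sign e (k * x) = has_sign e k.
Proof. by case: e => x0 /=; rewrite ?pmulr_lgt0 ?pmulr_llt0. Qed.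

Lemma collinearP e v : collinear e v <->
  row ord_max v != 0 /\
  exists2 k, has_sign e k & row (penult n) v = k *: row ord_max v.
Proof.
split=> [[nf s]|[w0 [k sk vE]]].
  have w0 : row ord_max v != 0.
    apply: contraTneq s => ->; rewrite /dot trmx0 mulmx0 mxE.
    by case: e => /=; rewrite ltxx.
  split => //; move: nf; rewrite free_cons span_seq1 seq1_free w0 andbT negbK.
  move=> /vlineP[k vE]; exists k => //; move: s.
  by rewrite vE dotZ has_signM ?dot_gt0.
split; last by rewrite vE dotZ has_signM ?dot_gt0.
rewrite free_cons span_seq1 seq1_free w0 andbT negbK.
by apply/vlineP; exists k.
Qed.

Lemma collinear_orth e (g : 'M[R]_3) v :
  g *m g^T = 1%:M -> collinear e v -> collinear e (v *m g).
Proof.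
move=> gg /collinearP[w0 [k sk vE]]; apply/collinearP.
rewrite !row_mul vE; split; last by exists k; rewrite // scalemxAl.
by rewrite -enorm_gt0 /enorm dot_orth// -/(enorm _) enorm_gt0.
Qed.

Lemma Dsub_repr e x : @Dsub e x -> collinear e (val (repr x)).
Proof.
case=> v cv vx; have : polygon_class v = polygon_class (repr x).
  by rewrite vx /polygon_class reprK.
by move=> /polygon_classP[g [gg _] ->]; exact: collinear_orth.
Qed.

Lemma row_fuse_max v :
  row ord_max (fuse_mx v) = row (penult n) v + row ord_max v.
Proof. by rewrite rowK eqxx. Qed.

Lemma row_fuse v j : j != ord_max ->
  row j (fuse_mx v) = row (lift ord_max j) v.
Proof. by move=> /negbTE jn; rewrite rowK jn. Qed.

Lemma fuse_mxM v (g : 'M[R]_3) : fuse_mx (v *m g) = fuse_mx v *m g.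
Proof.
apply/row_matrixP => j; rewrite row_mul.
have [->|jn] := eqVneq j ord_max.
  by rewrite !row_fuse_max !row_mul mulmxDl.
by rewrite !row_fuse// row_mul.
Qed.

Lemma sum_fuse v : \sum_j row j (fuse_mx v) = \sum_i row i v.
Proof.
rewrite (bigD1_ord ord_max)//= [RHS](bigD1_ord ord_max)//=.
rewrite [X in _ = _ + X](bigD1_ord ord_max)//= row_fuse_max [RHS]addrCA addrA.
congr (_ + _); by apply: eq_bigr => j _; rewrite row_fuse// eq_sym neq_lift.
Qed.

Lemma fuse_closed e v : closed_polygons alpha v -> collinear e v ->
  closed_polygons (alpha_pm e) (fuse_mx v).
Proof.
move=> [nv sv] /collinearP[w0 [k sk vE]]; split; last by rewrite sum_fuse.
move=> j; rewrite /alpha_pm; have [->|jn] := eqVneq j ord_max; last first.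
  by rewrite row_fuse.
have b0 : 0 <= alpha ord_max by rewrite -nv enorm_ge0.
rewrite row_fuse_max -!nv vE enormZ -{2}[row ord_max v]scale1r -scalerDl enormZ.
case: e sk => /= sk.
  by rewrite !gtr0_norm ?addr_gt0// mulrDl mul1r.
rewrite (ltr0_norm sk) mulNr -opprD normrN -{3}[enorm (row ord_max v)]mul1r.
by rewrite -mulrDl normrM (ger0_norm (enorm_ge0 _)).
Qed.

Definition fuse_polygon e (v : closed_polygons alpha)
    (cv : collinear e (val v)) : closed_polygons (alpha_pm e) :=
  exist _ (fuse_mx (val v)) (mem_set (fuse_closed (set_valP v) cv)).

(* The map s_e; it does not depend on the representative, see [fuse_class]. *)
Definition fuse e (x : Dsub e) : polygon_space (alpha_pm e) :=
  polygon_class (fuse_polygon (Dsub_repr (set_valP x))).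

Lemma fuse_class e (x : Dsub e) v (cv : collinear e (val v)) :
  val x = polygon_class v -> fuse x = polygon_class (fuse_polygon cv).
Proof.
move=> xv; apply/polygon_classP.
have : polygon_class (repr (val x)) = polygon_class v.
  by rewrite -xv /polygon_class reprK.
move=> /polygon_classP[g sg vE]; exists g => //=.
by rewrite vE fuse_mxM.
Qed.

(** The inverse of [fuse] cuts the last edge u into
   alpha_(m-1) / d *: u and (+/-) alpha_m / d *: u, where
   d = alpha_(m-1) (+/-) alpha_m. *)

Definition signed (e : pm) (x : R) : R := match e with Plus => x | Minus => - x end.

Definition signed_sum e : R := alpha (penult n) + signed e (alpha ord_max).

Definition cut_mx e (u : 'M[R]_(n.+1, 3)) : 'M[R]_(n.+2, 3) :=
  \matrix_i match unlift ord_max i with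
            | None => (signed e (alpha ord_max) / signed_sum e) *: row ord_max u
            | Some j => if j == ord_max
                        then (alpha (penult n) / signed_sum e) *: row ord_max u
                        else row j u
            end.

Lemma row_cut_max e u : row ord_max (cut_mx e u) =
  (signed e (alpha ord_max) / signed_sum e) *: row ord_max u.
Proof. by rewrite rowK unlift_none. Qed.

Lemma row_cut_penult e u : row (penult n) (cut_mx e u) =
  (alpha (penult n) / signed_sum e) *: row ord_max u.
Proof. by rewrite rowK liftK eqxx. Qed.

Lemma row_cut e u j : j != ord_max ->
  row (lift ord_max j) (cut_mx e u) = row j u.
Proof. by move=> /negbTE jn; rewrite rowK liftK jn. Qed.

Lemma cut_mxM e u (g : 'M[R]_3) : cut_mx e (u *m g) = cut_mx e u *m g.
Proof.
apply/row_matrixP => i; rewrite row_mul.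
have [j ->|->] := unliftP ord_max i; last first.
  by rewrite !row_cut_max row_mul scalemxAl.
have [->|jn] := eqVneq j ord_max.
  by rewrite !row_cut_penult row_mul scalemxAl.
by rewrite !row_cut// row_mul.
Qed.

Hypothesis alpha_gt0 : forall i, 0 < alpha i.
Hypothesis alpha_neq : alpha ord_max != alpha (penult n).

Lemma signed_sum_neq0 e : signed_sum e != 0.
Proof.
case: e; first by rewrite gt_eqF//; exact: (addr_gt0 (alpha_gt0 _) (alpha_gt0 _)).
by rewrite /signed_sum /= subr_eq0 eq_sym.
Qed.

Lemma alpha_pm_max e : alpha_pm e ord_max = `|signed_sum e|.
Proof. by case: e; rewrite /alpha_pm eqxx// gtr0_norm//; exact: (addr_gt0 (alpha_gt0 _) (alpha_gt0 _)). Qed.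

Lemma signed_norm e x : `|signed e x| = `|x|.
Proof. by case: e => //=; rewrite normrN. Qed.

Lemma fuse_cutK e u : fuse_mx (cut_mx e u) = u.
Proof.
apply/row_matrixP => j; have [->|jn] := eqVneq j ord_max.
  rewrite row_fuse_max row_cut_max row_cut_penult -scalerDl -mulrDl.
  by rewrite -/(signed_sum e) divff ?signed_sum_neq0// scale1r.
by rewrite row_fuse// row_cut.
Qed.

Lemma cut_closed e u : closed_polygons (alpha_pm e) u ->
  closed_polygons alpha (cut_mx e u).
Proof.
move=> [nu su]; split; last by rewrite -sum_fuse fuse_cutK.
move=> i; have [j ->|->] := unliftP ord_max i; last first.
  rewrite row_cut_max enormZ nu alpha_pm_max normrM normfV signed_norm.
  by rewrite divfK ?normr_eq0 ?signed_sum_neq0// gtr0_norm.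
have [->|jn] := eqVneq j ord_max.
  rewrite row_cut_penult enormZ nu alpha_pm_max normrM normfV.
  by rewrite divfK ?normr_eq0 ?signed_sum_neq0// gtr0_norm.
by rewrite row_cut// nu /alpha_pm (negbTE jn).
Qed.

Lemma cut_collinear e u : closed_polygons (alpha_pm e) u ->
  collinear e (cut_mx e u).
Proof.
move=> [nu su]; have u0 : row ord_max u != 0.
  by rewrite -enorm_gt0 nu alpha_pm_max normr_gt0 signed_sum_neq0.
have b0 : signed e (alpha ord_max) != 0.
  by rewrite -normr_eq0 signed_norm normr_eq0 gt_eqF.
have t0 := signed_sum_neq0 e.
apply/collinearP; rewrite row_cut_max row_cut_penult; split.
  by rewrite scaler_eq0 (negbTE u0) orbF mulf_neq0// invr_eq0.
exists (alpha (penult n) / signed e (alpha ord_max)).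
  by case: e {t0 nu b0} => /=; rewrite ?invrN ?mulrN ?oppr_lt0 divr_gt0.
by rewrite scalerA mulrA divfK.
Qed.

Definition cut_polygon e (u : closed_polygons (alpha_pm e)) :
    closed_polygons alpha :=
  exist _ (cut_mx e (val u)) (mem_set (cut_closed (set_valP u))).

Lemma cut_Dsub e u : Dsub e (polygon_class (@cut_polygon e u)).
Proof.
by exists (cut_polygon u) => //; exact: (cut_collinear (set_valP u)).
Qed.

Definition cut e (y : polygon_space (alpha_pm e)) : Dsub e :=
  exist _ (polygon_class (cut_polygon (repr y))) (mem_set (cut_Dsub (repr y))).

Lemma cut_class e (u : closed_polygons (alpha_pm e)) :
  val (cut (polygon_class u)) = polygon_class (cut_polygon u).
Proof.
apply/polygon_classP; have : polygon_class (repr (polygon_class u)) = polygon_class u.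
  by rewrite /polygon_class reprK.
by move=> /polygon_classP[g sg uE]; exists g => //=; rewrite uE cut_mxM.
Qed.

Lemma cutK e : cancel (@cut e) (@fuse e).
Proof.
move=> y; rewrite (@fuse_class _ _ (cut_polygon (repr y))
  (cut_collinear (set_valP (repr y))))//.
rewrite -[RHS]reprK; congr polygon_class; apply: val_inj => /=.
exact: fuse_cutK.
Qed.

Lemma cut_fuseK e v : closed_polygons alpha v -> collinear e v ->
  cut_mx e (fuse_mx v) = v.
Proof.
move=> [nv sv] /collinearP[w0 [k sk vE]].
have t0 := signed_sum_neq0 e.
have kE : alpha (penult n) = k * signed e (alpha ord_max).
  rewrite -!nv vE enormZ.
  case: e sk {t0} => /= sk; first by rewrite gtr0_norm.
  by rewrite ltr0_norm// mulrN mulNr.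
have b0 : signed e (alpha ord_max) != 0.
  by rewrite -normr_eq0 signed_norm normr_eq0 gt_eqF.
have tE : signed_sum e = (k + 1) * signed e (alpha ord_max).
  by rewrite /signed_sum kE mulrDl mul1r.
have k0 : k + 1 != 0 by apply: contraNneq t0; rewrite tE => ->; rewrite mul0r.
apply/row_matrixP => i; have [j ->|->] := unliftP ord_max i; last first.
  rewrite row_cut_max row_fuse_max vE -{2}[row ord_max v]scale1r -scalerDl.
  by rewrite scalerA tE mulrAC [_ * (k + 1)]mulrC divff ?mulf_neq0// scale1r.
have [->|jn] := eqVneq j ord_max.
  rewrite row_cut_penult row_fuse_max -/(penult n) vE.
  rewrite -{2}[row ord_max v]scale1r -scalerDl scalerA tE kE mulrAC -[k * _ * _]mulrA.
  by rewrite [_ * (k + 1)]mulrC mulfK// mulf_neq0.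
by rewrite row_cut// row_fuse.
Qed.

Lemma fuseK e : cancel (@fuse e) (@cut e).
Proof.
move=> x; apply: val_inj; rewrite cut_class.
transitivity (polygon_class (repr (val x))); last by rewrite /polygon_class reprK.
congr polygon_class; apply: val_inj => /=.
by apply: cut_fuseK; [exact: set_valP|exact/Dsub_repr/set_valP].
Qed.

Lemma cut_mx_continuous e : continuous (cut_mx e).
Proof.
have entry i j : continuous (fun u => cut_mx e u i j).
  have [t [k tk]] : exists t k, forall u, cut_mx e u i j = t * u k j.
    case: (unliftP ord_max i) => [k iE|iE].
      have [kE|kn] := eqVneq k ord_max.
        exists (alpha (penult n) / signed_sum e), ord_max => u.
        by rewrite mxE iE liftK kE eqxx !mxE.
      by exists 1, k => u; rewrite mxE iE liftK (negbTE kn) mxE mul1r.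
    exists (signed e (alpha ord_max) / signed_sum e), ord_max => u.
    by rewrite mxE iE unlift_none !mxE.
  have -> : (fun u => cut_mx e u i j) = 
      (fun u : 'M[R]_(n.+1, 3) => t * u k j) by exact/funext.
  move=> u; apply: (@continuousM R _ (cst t) (fun u : 'M[R]_(n.+1, 3) => u k j)).
    exact: cst_continuous.
  exact: coord_continuous.
move=> u A [P Pu PA].
have : \forall u' \near u, forall ij : 'I_n.+2 * 'I_3,
    P ij.1 ij.2 (cut_mx e u' ij.1 ij.2).
  have FF : Filter (nbhs u) by exact: (nbhs_filter (u : 'M[R]_(n.+1, 3))).
  apply: (@filter_forall _ _
    (fun ij u' => P ij.1 ij.2 (cut_mx e u' ij.1 ij.2)) _ FF) => -[i j].
  exact: (entry i j u _ (Pu i j)).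
by apply: filterS => u' Pu'; apply: PA => i j; exact: (Pu' (i, j)).
Qed.

Lemma incl_cut_continuous e : continuous (set_val \o @cut e).
Proof.
apply/quotient_continuous.
have -> : (set_val \o @cut e) \o \pi_(polygon_space (alpha_pm e)) =
    @polygon_class R _ alpha \o @cut_polygon e.
  by apply/funext => u; exact: cut_class.
move=> u; apply: continuous_comp; last exact: pi_continuous.
apply: continuous_comp_initial u => u.
have -> : set_val \o @cut_polygon e = cut_mx e \o set_val by [].
apply: continuous_comp; last exact: cut_mx_continuous.
exact: initial_continuous.
Qed.

(* The composite of s_e^-1 with the inclusion of Dsub e in the polygon space. *)
Definition incl_fuse_inv e :
    continuousType (polygon_space (alpha_pm e)) (polygon_space alpha) :=
  mkcts (@incl_cut_continuous e).

End Gluing.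

(* Main.v *)
Require Import Defs.
From mathcomp Require Import all_boot all_order all_algebra.
From mathcomp Require Import all_classical all_reals all_analysis.
From mathcomp Require Import ring lra zify.

Set Implicit Arguments.
Unset Strict Implicit.
Unset Printing Implicit Defensive.

Import Order.TTheory GRing.Theory Num.Theory numFieldNormedType.Exports.

Local Open Scope classical_set_scope.
Local Open Scope ring_scope.
Local Open Scope quotient_scope.

(** Every circle bundle [V_j] over a polygon space has exactly one class in the
   sense of [is_chern_class], and the map that fuses the last two edges is a
   map of circle bundles; naturality of the class under such maps is then the
   whole content of the identities.

   Fix a sign e, an edge i of the long polygons and the corresponding edge k of
   the short ones.  A point of [V_i(alpha)] whose class lies in [Dsub e] is a
   polygon with v_i = alpha_i ez and with v_(m-1), v_m on one line, so fusing
   them gives a short polygon whose k-th edge is + or - |edge| ez.  With the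
   plus sign it lies in [V_k]; with the minus sign a half turn about the x-axis
   moves it there, and this half turn conjugates the rotation by t about the
   z-axis to the rotation by - t.  The resulting map F from the part of
   [V_i(alpha)] over [Dsub e] to [V_k] covers the fusion and multiplies angles
   by d = 1 or d = -1, hence the restricted class is d times the class of [V_k]
   ([chern_class_pullback], [restrict_c1V]).  When i is one of the last two
   edges, d is the sign of the ratio between that edge and the fused one, which
   produces the factor sgn(alpha_(m-1) - alpha_m).

   The class is defined by a choice operator with default value 0, so existence
   and uniqueness carry the rest of the proof.

   Uniqueness ([chern_class_unique]): two systems of local sections differ by a
   phase, which has continuous local logarithms g_x; the transition logarithms
   f and f' then satisfy f_xy - f'_xy = g_x - g_y + an integer, and this integer
   cochain bounds the difference of the two cocycles.

   Existence ([chern_class_exists], [polygon_chern_class_exists]): the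
   transition functions must have logarithms on the whole overlaps, so the
   cover has to be fine enough.  The edges v_k that are not parallel to v_j give
   finitely many local sections of [V_j]: turn the polygon so that v_j points
   along ez and v_k lies in the half plane y = 0 < x.  Genericity means that at
   each polygon some v_k qualifies.  The squared area |v_j x v_k|^2 is a
   continuous function on the polygon space, positive exactly where the k-th
   section is defined, and comparing it with the sum of all these areas
   provides the shrinking needed to choose the cover point by point. *)

(** * Cochains of low degree *)

Section CechTools.
Context (X : topologicalType).

(** The 1-simplices are functions on ['I_2]; every such function is an [edge],
   which lets faces of higher simplices be compared by their vertices. *)
Definition edge (a b : X) : 'I_2 -> X := fun k => if k == ord0 then a else b.

Lemma edgeE (s : 'I_2 -> X) : s = edge (s ord0) (s ord_max).
Proof.
apply/funext => -[[|[|//]] k2]; rewrite /edge /=; congr s; exact: val_inj.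
Qed.

Lemma delta1E (A : pzRingType) (b : cochain X A 1) (s : 'I_3 -> X) z :
  delta b s z = b (edge (s 1) (s ord_max)) z
    - b (edge (s ord0) (s ord_max)) z + b (edge (s ord0) (s 1)) z.
Proof.
have E (i : 'I_3) (j k : 'I_3) : lift i ord0 = j -> lift i ord_max = k ->
    b (s \o lift i) z = b (edge (s j) (s k)) z.
  by move=> <- <-; rewrite [s \o lift i]edgeE.
rewrite /delta !big_ord_recl big_ord0 /= addr0 expr0 mul1r expr1 mulN1r addrA.
rewrite expr2 mulrNN mul1r mul1r.
by congr (_ - _ + _); apply: E; exact: val_inj.
Qed.

Lemma delta_delta1 (A : comNzRingType) (b : cochain X A 1) (s : 'I_4 -> X) z :
  delta (delta b) s z = 0.
Proof.
have sE k : s k = s (inord (val k)) by rewrite inord_val.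
pose F i j := b (edge (s (inord i)) (s (inord j))) z.
have E (i : 'I_4) : delta b (s \o lift i) z =
    F (bump i 1) (bump i 2) - F (bump i 0) (bump i 2) + F (bump i 0) (bump i 1).
  by rewrite delta1E /F ![(s \o _) _]sE.
rewrite [LHS](eq_bigr _ (fun i _ => congr1 _ (E i))) !big_ord_recl big_ord0.
rewrite /bump /= !expr0 !mul1r expr1 !exprS expr0 ?addn0 ?add0n !add1n.
by ring.
Qed.

Lemma intr_delta p (c : cochain X int p) (R : realType) (s : 'I_p.+2 -> X) z :
  (delta c s z)%:~R = delta (fun s z => (c s z)%:~R : R) s z.
Proof.
by rewrite /delta rmorph_sum; apply: eq_bigr => i _; rewrite rmorphM rmorph_sign.
Qed.

Lemma eq_delta (A : pzRingType) p (b c : cochain X A p) (s : 'I_p.+2 -> X) z :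
  (forall i, b (s \o lift i) z = c (s \o lift i) z) -> delta b s z = delta c s z.
Proof. by move=> bc; apply: eq_bigr => i _; rewrite bc. Qed.

Lemma overlap_lift (U : X -> set X) p (s : 'I_p.+2 -> X) (i : 'I_p.+2) z :
  overlap U s z -> overlap U (s \o lift i) z.
Proof. by move=> Us k; exact: Us. Qed.

Lemma open_overlap U p (s : 'I_p.+1 -> X) : open_cover U -> open (overlap U s).
Proof.
move=> hU; rewrite openE => z Uz; apply: filter_forall => i.
by apply: open_nbhs_nbhs; split; [have [] := hU (s i)|exact: Uz].
Qed.

(** A continuous function with integer values is locally constant: nearby values
   are integers at distance less than 1. *)
Lemma near_int_eq (R : realType) (W : set X) (f : X -> R) :
  open W -> (forall z, W z -> {for z, continuous f} /\ f z \is a Num.int) ->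
  locally_constant_on W (Num.floor \o f).
Proof.
move=> oW Wf z Wz; have [cf fz] := Wf z Wz.
have W' : \forall z' \near z, W z' by exact: open_nbhs_nbhs.
have f1 : \forall z' \near z, `|f z - f z'| < 1.
  by move/cvgrPdist_lt : cf; exact.
apply: filterS2 W' f1 => z' /Wf[_ /floorK fz'] /=.
rewrite -{1}fz' -{1}(floorK fz) -rmorphB /= ltr_norml.
rewrite -[-1]/((-1)%:~R) -[X in _ && (_ < X)]/(1%:~R) !ltr_int => /andP[].
lia.
Qed.

End CechTools.

Lemma H2_eqP (X : topologicalType) (c d : cocycle X) :
  is_coboundary (val c - val d) -> \pi_(H2 X) c = \pi_(H2 X) d.
Proof.
by move=> cd; apply/eqP; rewrite -Quotient.idealrBE; exact/asboolP.
Qed.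

(** * Chern classes of circle bundles *)

Section CircleBundle.
Context (R : realType) (X P : topologicalType).
Variables (act : R -> P -> P) (pr : P -> X).

Definition continuous_section (W : set X) (sigma : X -> P) :=
  forall z, W z -> pr (sigma z) = z /\ {for z, continuous sigma}.

(** Besides freeness, local triviality enters only through [circle_phase]: two
   sections over the same open set differ by a phase with a continuous logarithm
   near each point. Angles are measured in turns, so that free means that only
   integers act trivially. *)
Record circle_bundle : Prop := CircleBundle {
  circle_act0 : forall p, act 0 p = p;
  circle_actD : forall s t p, act s (act t p) = act (s + t) p;
  circle_free : forall t p, act (2 * pi * t) p = p -> t \is a Num.int;
  circle_phase : forall W sigma tau x, open W -> W x ->
    continuous_section W sigma -> continuous_section W tau ->
    exists N, exists g : X -> R, [/\ open N, N x & forall z, N z ->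
      {for z, continuous g} /\ sigma z = act (2 * pi * g z) (tau z)] }.

Hypothesis bundle : circle_bundle.

Lemma circle_phase_int s t p :
  act (2 * pi * s) p = act (2 * pi * t) p -> s - t \is a Num.int.
Proof.
move=> /(congr1 (act (- (2 * pi * t)))); rewrite !(circle_actD bundle) addNr.
rewrite (circle_act0 bundle) => st; apply: (circle_free bundle (p := p)).
by rewrite -[RHS]st; congr act; ring.
Qed.

(** On a common refinement, f - f' - (g_x - g_y) is an integer, where g_x is a
   logarithm of the phase between the two sections at x, because both f + g_y and
   g_x + f' are logarithms of the same phase. The g part is a coboundary, so the
   integer cochain bounds the difference of the cocycles. *)
Lemma chern_class_unique : is_subset1 [set h | is_chern_class act pr h].
Proof.
move=> h h' [c [-> [U [sigma [f [hU sP fC sf cf]]]]]].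
move=> [c' [-> [U' [sigma' [f' [hU' sP' fC' sf' cf']]]]]].
apply: H2_eqP.
have /choice[N /choice[g Ng]] : forall x, exists N, exists g : X -> R,
   [/\ open N, N x & forall z, N z -> {for z, continuous g} /\
      sigma x z = act (2 * pi * g z) (sigma' x z)].
  move=> x; have [oU Ux] := hU x; have [oU' Ux'] := hU' x.
  apply: (circle_phase bundle (W := U x `&` U' x)) => //; first exact: openI.
  - by move=> z [/sP].
  - by move=> z [_ /sP'].
pose V x := U x `&` U' x `&` N x.
have hV : open_cover V.
  by apply: open_coverI; [exact: open_coverI|move=> x; have [] := Ng x].
have VP (p : nat) (s : 'I_p.+1 -> X) z : overlap V s z ->
    [/\ overlap U s z, overlap U' s z & overlap N s z].
  by move=> /overlapI[/overlapI[]].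
pose d (s : 'I_2 -> X) z := f s z - f' s z - g (s ord0) z + g (s ord_max) z.
have d_int s z : overlap V s z -> d s z \is a Num.int.
  move=> /VP[Us Us' Ns].
  have [_ _ /(_ _ (Ns ord0))[_ g0]] := Ng (s ord0).
  have [_ _ /(_ _ (Ns ord_max))[_ g1]] := Ng (s ord_max).
  have := sf _ _ Us; rewrite g0 g1 (sf' _ _ Us') !(circle_actD bundle) -!mulrDr.
  move=> /esym/circle_phase_int; congr (_ \is a _); rewrite /d; ring.
exists V, (fun s => Num.floor \o d s); split => //.
- move=> s; apply: near_int_eq; first exact: open_overlap.
  move=> z Vs; split; last exact: d_int.
  have [Us Us' Ns] := VP _ _ _ Vs.
  have [_ _ /(_ _ (Ns ord0))[g0 _]] := Ng (s ord0).
  have [_ _ /(_ _ (Ns ord_max))[g1 _]] := Ng (s ord_max).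
  have := fC _ _ Us; have := fC' _ _ Us'; move=> f1 f0.
  apply: continuousD g1; apply: continuousB g0; exact: continuousB.
- move=> s z Vs; have [Us Us' Ns] := VP _ _ _ Vs.
  apply: (@intr_inj R); rewrite intr_delta.
  rewrite (@eq_delta _ _ _ _ d); last first.
    by move=> i; rewrite /= floorK// d_int//; exact: overlap_lift.
  by rewrite rmorphB /= cf// cf'// !delta1E /d /edge /=; ring.
Qed.

(** Shrinking argument. Each x picks an index k(x) with [psi (k x) x > 0], and
   U x lies in [psi (k x) > 0], in [psi i < 0] for each i with [psi i x < 0], and
   for every other i in a neighbourhood of x where the phase between the sections
   k(x) and i has a continuous logarithm. If U x meets U y then
   [psi (k y) x < 0] is impossible, so the logarithm for the pair (k(x), k(y))
   chosen at x serves on all of the overlap. *)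
Lemma chern_class_exists (I : finType) (W : I -> set X) (tau : I -> X -> P)
    (psi : I -> X -> R) :
  (forall i, open (W i)) -> (forall i, continuous_section (W i) (tau i)) ->
  (forall i, continuous (psi i)) -> (forall i z, 0 <= psi i z -> W i z) ->
  (forall z, exists i, 0 < psi i z) ->
  exists h, is_chern_class act pr h.
Proof.
move=> oW secW psiC psiW /choice[k kP].
have /choice[N /choice[g Ng]] : forall xi : X * I, exists N, exists g : X -> R,
    [/\ open N, N xi.1,
      psi xi.2 xi.1 < 0 -> forall z, N z -> psi xi.2 z < 0 &
      0 <= psi xi.2 xi.1 -> forall z, N z -> {for z, continuous g} /\
        tau (k xi.1) z = act (2 * pi * g z) (tau xi.2 z)].
  move=> [x i] /=; have [psi0|psi0] := leP 0 (psi i x).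
    have := circle_phase bundle (W := W (k x) `&` W i) (x := x)
      (sigma := tau (k x)) (tau := tau i).
    case; [exact: openI|by split; apply: psiW => //; exact: ltW|..].
    - by move=> z [/secW].
    - by move=> z [_ /secW].
    - by move=> N [g [oN Nx Ng]]; exists N, g; split.
  exists (psi i @^-1` [set y | y < 0]), 0; split => //.
  apply: open_comp; last exact: open_lt.
  by move=> z _; exact: psiC.
pose U x := [set z | 0 < psi (k x) z /\ forall i, N (x, i) z].
have hU : open_cover U.
  move=> x; split; last by split => // i; have [] := Ng (x, i).
  apply: openI.
    apply: (@open_comp _ _ (psi (k x)) [set y | 0 < y]); last exact: open_gt.
    by move=> z _; exact: psiC.
  rewrite openE => z Nz; apply: filter_forall => i.
  by apply: open_nbhs_nbhs; split; [have [] := Ng (x, i)|exact: Nz].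
pose f (s : 'I_2 -> X) z := g (s ord0, k (s ord_max)) z.
have fP s z : overlap U s z -> {for z, continuous (f s)} /\
    tau (k (s ord0)) z = act (2 * pi * f s z) (tau (k (s ord_max)) z).
  move=> Us; have [_ /(_ (k (s ord_max))) Nz] := Us ord0.
  have [psi1 _] := Us ord_max.
  have [_ _ n p] := Ng (s ord0, k (s ord_max)); apply: p => //=.
  by rewrite leNgt; apply/negP => /n/(_ z Nz); rewrite ltNge ltW.
have df s z : overlap U s z -> {for z, continuous (delta f s)} /\
    delta f s z \is a Num.int.
  move=> Us.
  have Ue i j : overlap U (edge (s i) (s j)) z.
    by move=> l; rewrite /edge; case: ifP => _; exact: Us.
  have [c12 t12] := fP _ _ (Ue 1 ord_max).
  have [c02 t02] := fP _ _ (Ue ord0 ord_max).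
  have [c01 t01] := fP _ _ (Ue ord0 1).
  split.
    rewrite (_ : delta f s = f (edge (s 1) (s ord_max))
      - f (edge (s ord0) (s ord_max)) + f (edge (s ord0) (s 1))); last first.
      by apply/funext => z'; rewrite delta1E.
    by apply: continuousD => //; exact: continuousB.
  rewrite delta1E; move: t12 t02 t01; rewrite /edge /= => -> ->.
  rewrite (circle_actD bundle) -mulrDr => /esym/(circle_phase_int).
  by congr (_ \is a _); ring.
pose c (s : 'I_3 -> X) := Num.floor \o delta f s.
have c_cocycle : c \in @cocycles X.
  apply/asboolP; exists U; split => //.
    by move=> s; apply: near_int_eq; [exact: open_overlap|exact: df].
  move=> s z Us; apply: (@intr_inj R); rewrite intr_delta.
  rewrite (@eq_delta _ _ _ _ (delta f)) ?delta_delta1// => i.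
  by rewrite /= floorK//; have [] := df _ _ (overlap_lift i Us).
exists (\pi_(H2 X) (Cocycle c_cocycle)), (Cocycle c_cocycle); split => //.
exists U, (fun x => tau (k x)), f; split => //.
- by move=> x z [psi0 _]; apply: secW; apply: psiW; exact: ltW.
- by move=> s z /fP[].
- by move=> s z /fP[].
- by move=> s z /df[_ /floorK].
Qed.

End CircleBundle.

Lemma fctMz (T : Type) (A : zmodType) (f : T -> A) (m : int) x :
  (f *~ m) x = f x *~ m.
Proof.
have fctMn (g : T -> A) j : (g *+ j) x = g x *+ j.
  by elim: j => [|j IHj]; rewrite ?mulr0n// !mulrS -IHj.
by case: m => j; rewrite /intmul/= ?fctMn// -fctMn.
Qed.

(** Naturality for maps of degree d. [F] need only make sense on the part of Q
   that lies over the image of phi, which is why each condition on it is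
   restricted to such points; transporting sections by [F] multiplies the
   logarithms of the transition functions by d. *)
Lemma chern_class_pullback (R : realType) (X Y P Q : topologicalType)
    (actP : R -> P -> P) (prP : P -> X) (actQ : R -> Q -> Q) (prQ : Q -> Y)
    (phi : continuousType X Y) (d : int) (F : Q -> P) (h : H2 Y) :
  (forall q z, prQ q = phi z -> prP (F q) = z) ->
  (forall t q z, prQ q = phi z -> F (actQ t q) = actP (d%:~R * t) (F q)) ->
  (forall sigma z, (\forall z' \near z, prQ (sigma z') = phi z') ->
    {for z, continuous sigma} -> {for z, continuous (F \o sigma)}) ->
  is_chern_class actQ prQ h -> is_chern_class actP prP (pullback phi h *~ d).
Proof.
move=> Fpr Fact Fcont [c [-> [U [sigma [f [hU sP fC sf cf]]]]]].
exists (cocycle_pullback phi c *~ d); split.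
  by rewrite pullback_pi raddfMz.
exists (fun x => phi @^-1` U (phi x)), (fun x => F \o sigma (phi x) \o phi).
exists (fun s z => d%:~R * f (phi \o s) (phi z)); split.
- exact: open_cover_pullback.
- move=> x z Uz /=; have [sz sc] := sP _ _ Uz; split; first exact: Fpr.
  apply: (Fcont (sigma (phi x) \o phi)).
    have : \forall z' \near z, (phi @^-1` U (phi x)) z'.
      apply: open_nbhs_nbhs; split => //.
      by have [] := open_cover_pullback phi hU x.
    by apply: filterS => z' /sP[].
  by apply: continuous_comp; [exact: cts_fun|exact: sc].
- move=> s z Us; apply: continuousM; first exact: cst_continuous.
  by apply: continuous_comp; [exact: cts_fun|exact: (fC (phi \o s))].
- move=> s z Us /=; have [s1 _] := sP _ _ (Us ord_max).
  rewrite (sf (phi \o s) _ Us) /= (Fact _ _ _ s1).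
  by congr actP; ring.
- move=> s z Us; rewrite raddfMz /= !fctMz /= rmorphMz/=.
  rewrite -mulrzl /delta.
  have := cf (phi \o s) _ Us; rewrite /= {1}/cochain_pullback => ->.
  rewrite /delta mulr_sumr; apply: eq_bigr => i _.
  by rewrite mulrCA.
Qed.

(** An empty polygon space has to be treated apart, since the bundle over it has
   no point that could serve as a default value of the local sections. *)
Lemma chern_class_empty (R : realType) (X P : topologicalType)
    (act : R -> P -> P) (pr : P -> X) (h : H2 X) :
  (X -> False) -> is_chern_class act pr h.
Proof.
move=> X0; exists (repr h); split; first by rewrite reprK.
exists (fun=> setT), (fun x => False_rect _ (X0 x)), 0.
by split => x; [case: (X0 x)|case: (X0 x)|case: (X0 (x ord0))..].
Qed.

(** * Angles *)

Section Angles.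
Context (R : realType).
Implicit Types t : R.

Lemma sin_pi_int (m : int) : sin (pi * m%:~R) = 0 :> R.
Proof.
have nat_case k : sin (pi * k%:R) = 0 :> R.
  by rewrite mulr_natr -[_ *+ _]add0r (alternatingn (@sinDpi R)) sin0 mulr0.
by case: m => k; rewrite ?NegzE ?rmorphN ?mulrN ?sinN /= ?natz nat_case ?oppr0.
Qed.

(** By the half-angle formula sin (pi t) = 0, and sin is positive inside (0, pi),
   so the fractional part of t vanishes. *)
Lemma cos_eq1_int t : cos (2 * pi * t) = 1 -> t \is a Num.int.
Proof.
move=> ct; have st : sin (pi * t) = 0.
  have : cos (pi * t *+ 2) = 1 by rewrite -ct; congr cos; rewrite mulr2n; ring.
  rewrite cosD -expr2 -expr2 cos2sin2 => s2.
  by apply/eqP; rewrite -sqrf_eq0; apply/eqP; lra.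
have /andP[t0 t1] := real_floor_itv (num_real t).
have su : sin (pi * (t - (Num.floor t)%:~R)) = 0.
  by rewrite mulrBr sinB st sin_pi_int mul0r mulr0 subr0.
have [u0|u0] := eqVneq (t - (Num.floor t)%:~R) 0.
  by rewrite (subr0_eq u0).
suff : 0 < sin (pi * (t - (Num.floor t)%:~R)) by rewrite su ltxx.
apply: sin_gt0_pi; rewrite mulr_gt0 ?pi_gt0//=; last first.
  by rewrite lt_neqAle eq_sym u0 subr_ge0.
rewrite -ltr_pdivlMl ?pi_gt0// mulVf ?gt_eqF ?pi_gt0//.
by move: t1; rewrite rmorphD /=; lra.
Qed.

Lemma angle_exists (a b : R) : a ^+ 2 + b ^+ 2 = 1 ->
  exists t, cos t = a /\ sin t = b.
Proof.
move=> ab; have a1 : -1 <= a <= 1 by have b0 := sqr_ge0 b; apply/andP; split; nra.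
have sE : sin (acos a) = `|b|.
  by rewrite sin_acos// -ab addrC addKr sqrtr_sqr.
have [b0|b0] := leP 0 b.
  by exists (acos a); rewrite acosK ?in_itv//= sE ger0_norm.
by exists (- acos a); rewrite cosN sinN acosK ?in_itv//= sE ltr0_norm// opprK.
Qed.

(** The arctangent recovers an angle d from the vector (r cos d, r sin d) up to a
   multiple of 2 pi as soon as this vector is in the right half plane; unlike d
   itself, the arctangent depends continuously on the vector. *)
Lemma atan_quotient (r d : R) : 0 < r * cos d -> 0 <= r ->
  let t := atan (r * sin d / (r * cos d)) in cos t = cos d /\ sin t = sin d.
Proof.
move=> rc r0 t; have rn0 : r != 0 by apply: contraTneq rc => ->; rewrite mul0r ltxx.
have r_gt0 : 0 < r by rewrite lt_neqAle eq_sym rn0.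
have c0 : 0 < cos d by move: rc; rewrite pmulr_rgt0.
have tE : t = atan (tan d) by rewrite /t -mulf_div divff// mul1r.
have ct : cos t = cos d.
  rewrite tE cos_atan -[cos d]invrK; congr _^-1.
  rewrite -cos2_tan2 ?lt0r_neq0// -exprVn.
  by rewrite sqrtr_sqr gtr0_norm ?invr_gt0.
split => //; have := atanK (tan d); rewrite -tE /tan ct => /divIf; apply.
exact: lt0r_neq0.
Qed.

End Angles.

(** * Rotations of space and orthonormal frames *)

Section Matrices.
Context (R : realType).

Lemma matrix_continuous_at (T : topologicalType) m n (f : T -> 'M[R]_(m, n)) z :
  (forall i j, {for z, continuous (fun x => f x i j)}) -> {for z, continuous f}.
Proof.
move=> fC A [P Pu PA].
have FF : Filter (nbhs z) by exact: nbhs_filter.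
have : \forall x \near z, forall ij : 'I_m * 'I_n, P ij.1 ij.2 (f x ij.1 ij.2).
  apply: (@filter_forall _ _
    (fun ij x => P ij.1 ij.2 (f x ij.1 ij.2)) _ FF) => -[i j].
  exact: (fC i j _ (Pu i j)).
by apply: filterS => u' Pu'; apply: PA => i j; exact: (Pu' (i, j)).
Qed.

Lemma det3E (A : 'M[R]_3) : \det A =
  A 0 0 * (A 1 1 * A ord_max ord_max - A 1 ord_max * A ord_max 1)
  - A 0 1 * (A 1 0 * A ord_max ord_max - A 1 ord_max * A ord_max 0)
  + A 0 ord_max * (A 1 0 * A ord_max 1 - A 1 1 * A ord_max 0).
Proof.
have [f fE] : exists f : nat -> nat -> R, forall i j : 'I_3, A i j = f i j.
  by exists (fun i j => A (inord i) (inord j)) => i j; rewrite !inord_val.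
rewrite (expand_det_row _ ord0) !big_ord_recl big_ord0 /cofactor.
rewrite !(expand_det_row _ ord0) !big_ord_recl !big_ord0 /cofactor !det_mx11 !mxE.
rewrite !fE /= /bump /=.
ring.
Qed.

Lemma sum3E (F : 'I_3 -> R) : \sum_i F i = F 0 + F 1 + F ord_max.
Proof.
rewrite !big_ord_recl big_ord0 addr0 addrA.
by congr (_ + F _ + F _); exact: val_inj.
Qed.

Lemma ord3_ind (Q : 'I_3 -> Prop) : Q 0 -> Q 1 -> Q ord_max -> forall i, Q i.
Proof.
move=> Q0 Q1 Q2 -[[|[|[|//]]] ilt].
- by rewrite (_ : Ordinal ilt = 0)//; exact: val_inj.
- by rewrite (_ : Ordinal ilt = 1)//; exact: val_inj.
- by rewrite (_ : Ordinal ilt = ord_max)//; exact: val_inj.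
Qed.

Lemma dot3E (u v : 'rV[R]_3) :
  dot u v = u 0 0 * v 0 0 + u 0 1 * v 0 1 + u 0 ord_max * v 0 ord_max.
Proof. by rewrite /dot mxE sum3E !mxE. Qed.

Lemma dotC (u v : 'rV[R]_3) : dot u v = dot v u.
Proof. by rewrite !dot3E; ring. Qed.

Lemma mul_rotz m (v : 'M[R]_(m, 3)) t i :
  [/\ (v *m rotz t) i 0 = v i 0 * cos t - v i 1 * sin t,
      (v *m rotz t) i 1 = v i 0 * sin t + v i 1 * cos t &
      (v *m rotz t) i ord_max = v i ord_max].
Proof. by split; rewrite mxE sum3E !mxE /=; ring. Qed.

Lemma rotzD s t : rotz s *m rotz t = rotz (s + t) :> 'M[R]_3.
Proof.
apply/matrixP => i j; have [e0 e1 e2] := mul_rotz (rotz s) t i.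
elim/ord3_ind: j; rewrite ?e0 ?e1 ?e2; elim/ord3_ind: i {e0 e1 e2};
  rewrite !mxE /= ?cosD ?sinD; ring.
Qed.

Lemma rotz0 : rotz 0 = 1%:M :> 'M[R]_3.
Proof.
by apply/matrixP => i j; elim/ord3_ind: i; elim/ord3_ind: j;
  rewrite !mxE /= ?cos0 ?sin0 ?oppr0.
Qed.

Lemma eq_rotz s t : cos s = cos t -> sin s = sin t -> rotz s = rotz t :> 'M[R]_3.
Proof. by rewrite /rotz => -> ->. Qed.

(** Orthogonality leaves a 2 x 2 block (a, b; c, d) with rows of norm 1 and
   determinant 1, and then (a - d)^2 + (b + c)^2 = 2 - 2 (ad - bc) = 0. *)
Lemma SO3_fix_ez (g : 'M[R]_3) : SO3 g -> ez R *m g = ez R ->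
  exists t, g = rotz t.
Proof.
move=> [gg dg] ezg.
have g2 j : g ord_max j = (j == ord_max)%:R.
  by have /rowP/(_ j) := ezg; rewrite /ez -rowE !mxE.
have e i j : \sum_k g i k * g j k = (i == j)%:R.
  by have /matrixP/(_ i j) := gg; rewrite !mxE => <-; apply: eq_bigr => k _; rewrite !mxE.
have e02 := e 0 ord_max; have e12 := e 1 ord_max.
have e00 := e 0 0; have e01 := e 0 1; have e11 := e 1 1.
move: dg e02 e12 e00 e01 e11; rewrite det3E !sum3E !g2 /=.
rewrite !(mulr0, mulr1, add0r, subr0) => dg g02 g12.
rewrite g02 g12 !(mulr0, addr0) in dg * => e00 e01 e11.
have sq : (g 0 0 - g 1 1) ^+ 2 + (g 0 1 + g 1 0) ^+ 2 = 0.
  by rewrite sqrrB sqrrD !expr2; lra.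
have p1 := sqr_ge0 (g 0 0 - g 1 1); have p2 := sqr_ge0 (g 0 1 + g 1 0).
have d1 : g 0 0 - g 1 1 = 0 by apply/eqP; rewrite -sqrf_eq0; apply/eqP; lra.
have d2 : g 0 1 + g 1 0 = 0 by apply/eqP; rewrite -sqrf_eq0; apply/eqP; lra.
have [t [ct st]] : exists t, cos t = g 0 0 /\ sin t = g 0 1.
  by apply: angle_exists; rewrite !expr2.
exists t; apply/matrixP => i j.
by elim/ord3_ind: i; elim/ord3_ind: j; rewrite !mxE /= ?ct ?st ?g02 ?g12 ?g2//=; lra.
Qed.

Definition cross (a c : 'rV[R]_3) : 'rV[R]_3 :=
  \row_i [:: a 0 1 * c 0 ord_max - a 0 ord_max * c 0 1;
             a 0 ord_max * c 0 0 - a 0 0 * c 0 ord_max;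
             a 0 0 * c 0 1 - a 0 1 * c 0 0]`_i.

(** The Gram determinant |a x c|^2, which vanishes exactly when a and c are
   linearly dependent. *)
Definition gram (a c : 'rV[R]_3) := dot a a * dot c c - dot a c ^+ 2.

(** The columns are the orthonormal basis obtained from c, a x c and a: first the
   part of c orthogonal to a, then a x c, then a, each normalised. Right
   multiplication by this matrix takes coordinates in that basis, so it moves a to
   the positive z-axis and c to the half plane y = 0 < x. *)
Definition frame (a c : 'rV[R]_3) : 'M[R]_3 :=
  \matrix_(i, j) [:: (dot a a * c 0 i - dot a c * a 0 i) / (enorm a * Num.sqrt (gram a c));
     cross a c 0 i / Num.sqrt (gram a c); a 0 i / enorm a]`_j.

Lemma gram_gt0 a c : 0 < gram a c -> 0 < dot a a /\ 0 < dot c c.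
Proof.
rewrite /gram => g; have a0 := dot_ge0 a; have c0 := dot_ge0 c.
have p : 0 < dot a a * dot c c by have := sqr_ge0 (dot a c); lra.
have n0 : dot a a * dot c c != 0 by rewrite gt_eqF.
move: n0; rewrite mulf_eq0 negb_or => /andP[na nc].
by rewrite !lt_neqAle a0 c0 !(eq_sym 0) na nc.
Qed.

Lemma frame_SO3 a c : 0 < gram a c -> SO3 (frame a c).
Proof.
move=> g0; have [a0 _] := gram_gt0 g0.
have [B B2 EB] : exists2 B, dot a a * B ^+ 2 = 1 & (enorm a)^-1 = B.
  exists (enorm a)^-1 => //; rewrite exprVn sqr_sqrtr ?ltW// divff//.
  exact: lt0r_neq0.
have [Q Q2 EQ] : exists2 Q, gram a c * Q ^+ 2 = 1 & (Num.sqrt (gram a c))^-1 = Q.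
  exists (Num.sqrt (gram a c))^-1 => //; rewrite exprVn sqr_sqrtr ?ltW// divff//.
  exact: lt0r_neq0.
(* With B and Q the inverse lengths, each entry of the product and the
   determinant become polynomial identities in the coordinates, once 1 is written
   as the product of the two normalisations. *)
have one : 1 = (dot a a * B ^+ 2) * (gram a c * Q ^+ 2) by rewrite B2 Q2 mulr1.
split.
  apply: mulmx1C; apply/matrixP => i j; rewrite mxE sum3E !mxE.
  elim/ord3_ind: i; elim/ord3_ind: j => /=; rewrite ?mxE /= ?invfM ?EQ ?EB.
  - by rewrite one /gram !dot3E; ring.
  - by rewrite !dot3E; ring.
  - by rewrite !dot3E; ring.
  - by rewrite !dot3E; ring.
  - by rewrite -Q2 /gram !dot3E; ring.
  - by ring.
  - by rewrite !dot3E; ring.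
  - by ring.
  - by rewrite -B2 /gram !dot3E; ring.
by rewrite det3E !mxE /= ?mxE /= invfM EQ EB one /gram !dot3E; ring.
Qed.

Lemma mul_frame n (v : 'M[R]_(n, 3)) (a c : 'rV[R]_3) i :
  [/\ (v *m frame a c) i 0 = (dot a a * dot (row i v) c
         - dot a c * dot (row i v) a) / (enorm a * Num.sqrt (gram a c)),
      (v *m frame a c) i 1 = dot (row i v) (cross a c) / Num.sqrt (gram a c) &
      (v *m frame a c) i ord_max = dot (row i v) a / enorm a].
Proof.
split; rewrite mxE sum3E !mxE /=; first by rewrite !dot3E !mxE; ring.
- by rewrite dot3E !mxE /= ?mxE; ring.
- by rewrite [dot _ _]dot3E !mxE; ring.
Qed.

Lemma mul_frame_ez (a c : 'rV[R]_3) : 0 < gram a c ->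
  a *m frame a c = enorm a *: ez R.
Proof.
move=> g0; have [a0 _] := gram_gt0 g0; have [e0 e1 e2] := mul_frame a a c 0.
have aa : row 0 a = a by apply/rowP => i; rewrite mxE.
apply/rowP => i; rewrite [RHS]mxE [ez R _ _]mxE.
elim/ord3_ind: i; rewrite ?e0 ?e1 ?e2 aa /=.
- by rewrite [X in X / _](_ : _ = 0) ?mul0r ?mulr0// dotC; ring.
- rewrite [dot _ _](_ : _ = 0) ?mul0r ?mulr0//.
  by rewrite dot3E !mxE /=; ring.
- rewrite mulr1; apply: (canLR (mulfK _)).
    by rewrite gt_eqF// sqrtr_gt0.
  by rewrite -expr2 sqr_sqrtr// ltW.
Qed.

(** The triple product is a determinant. *)
Lemma triple_mul (g : 'M[R]_3) (u a c : 'rV[R]_3) :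
  dot (u *m g) (cross (a *m g) (c *m g)) = \det g * dot u (cross a c).
Proof.
have E (x y w : 'rV[R]_3) : dot x (cross y w) = \det (\matrix_i [:: x; y; w]`_i).
  by rewrite det3E dot3E !mxE /=; ring.
rewrite !E mulrC -det_mulmx; congr (\det _); apply/row_matrixP => i.
by rewrite row_mul !rowK; elim/ord3_ind: i.
Qed.

(** Lagrange's identity. *)
Lemma gram_cross (a c : 'rV[R]_3) : gram a c = dot (cross a c) (cross a c).
Proof. by rewrite /gram !dot3E !mxE /=; ring. Qed.

Lemma gram_ge0 (a c : 'rV[R]_3) : 0 <= gram a c.
Proof. by rewrite gram_cross dot_ge0. Qed.

End Matrices.

(** * The circle bundles over polygon spaces *)

Section ContinuousAt.
Context (R : realType) (T : topologicalType).
Implicit Types (f g : T -> R) (z : T).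

(** The sum, difference and product are kept as formulas in x, so that
   continuity of a formula reduces by unification to that of its parts. *)
Lemma continuousD_at f g z : {for z, continuous f} -> {for z, continuous g} ->
  {for z, continuous (fun x => f x + g x)}.
Proof. exact: continuousD. Qed.

Lemma continuousB_at f g z : {for z, continuous f} -> {for z, continuous g} ->
  {for z, continuous (fun x => f x - g x)}.
Proof. exact: continuousB. Qed.

Lemma continuousM_at f g z : {for z, continuous f} -> {for z, continuous g} ->
  {for z, continuous (fun x => f x * g x)}.
Proof. exact: continuousM. Qed.

End ContinuousAt.

Section PolygonBundle.
Context (R : realType) (n : nat) (beta : 'I_n -> R) (j : 'I_n).
Hypothesis beta_generic : generic beta.
Hypothesis beta_gt0 : 0 < beta j.

Local Notation M := (polygon_space beta).
Local Notation V := (Vset beta j).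

Lemma closed_polygon_dot v i : closed_polygons beta v ->
  dot (row i v) (row i v) = beta i ^+ 2.
Proof. by move=> [<- _]; rewrite sqr_sqrtr ?dot_ge0. Qed.

(** If every v_k were parallel to v_j, then <v_j, v_k> = +/- beta_j beta_k for
   all k; summing over k gives 0 since the polygon is closed, against
   genericity. *)
Lemma exists_transverse v : closed_polygons beta v ->
  exists k, 0 < gram (row j v) (row k v).
Proof.
move=> Pv; apply: contrapT => /forallNP G.
have D k : dot (row j v) (row k v) =
    beta j * ((-1) ^+ (dot (row j v) (row k v) < 0)%R * beta k).
  have bk : 0 <= beta k by have [<- _] := Pv; exact: enorm_ge0.
  have g0 : gram (row j v) (row k v) = 0.
    by apply: le_anti; rewrite gram_ge0 andbT leNgt; exact/negP/G.
  have d2 : dot (row j v) (row k v) ^+ 2 = (beta j * beta k) ^+ 2.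
    rewrite exprMn -!(closed_polygon_dot _ Pv).
    by move: g0; rewrite /gram; lra.
  have d : `|dot (row j v) (row k v)| = beta j * beta k.
    have p := mulr_ge0 (ltW beta_gt0) bk.
    by rewrite -(ger0_norm p) -!sqrtr_sqr d2.
  rewrite mulrCA -d; case: ltrP => d0; last by rewrite expr0 mul1r ger0_norm.
  by rewrite expr1 ltr0_norm// mulN1r opprK.
have : \sum_k dot (row j v) (row k v) = 0.
  have [_ s0] := Pv; transitivity (dot (row j v) (\sum_k row k v)).
    rewrite /dot linear_sum /= mulmx_sumr summxE.
    by apply: eq_bigr => k _.
  by rewrite s0 /dot trmx0 mulmx0 mxE.
under eq_bigr do rewrite D.
rewrite -mulr_sumr => /eqP; rewrite mulf_eq0 gt_eqF//=.
apply/negP; exact: (beta_generic (fun k => dot (row j v) (row k v) < 0)).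
Qed.

(** The rotation relating the two polygons preserves their common j-th edge, a
   positive multiple of ez. *)
Lemma V_proj_eq (p q : V) : V_proj p = V_proj q ->
  exists t, val q = val p *m rotz t.
Proof.
move=> /polygon_classP[g sg /= qE].
have [t gE] : exists t, g = rotz t.
  apply: SO3_fix_ez => //; have [_ pj] := set_valP p; have [_ qj] := set_valP q.
  apply: (scalerI (lt0r_neq0 beta_gt0)).
  by rewrite scalemxAl -{1}pj -row_mul -qE; exact: qj.
by exists t; rewrite qE gE.
Qed.

(** With v_j = beta_j ez, the Gram determinant of v_j and v_k is beta_j^2 times the
   squared length of the horizontal part of v_k. *)
Lemma V_off_axis (p : V) :
  exists k, 0 < (val p k 0) ^+ 2 + (val p k 1) ^+ 2.
Proof.
have [Pp pj] := set_valP p; have [k] := exists_transverse Pp.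
rewrite pj gram_cross dot3E !mxE /= !(mulr0, mulr1, mul0r, sub0r, subr0, addr0).
move=> g0; exists k.
have : 0 < beta j ^+ 2 * (val p k 0 ^+ 2 + val p k 1 ^+ 2).
  by move: g0; congr (0 < _) => /=; ring.
by rewrite pmulr_rgt0// exprn_gt0.
Qed.

Lemma V_coord_continuous i k : continuous (fun p : V => val p i k).
Proof.
move=> p; apply: (@continuous_comp _ _ _ (set_val : V -> _)
  (fun w : 'M[R]_(n, 3) => w i k)); first exact: initial_continuous.
exact: coord_continuous.
Qed.

Lemma V_continuous_at (T : topologicalType) (f : T -> V) z :
  {for z, continuous (fun x => val (f x))} -> {for z, continuous f}.
Proof.
move=> fC U [_ /= [[W oW <-]]] /= Wfz /filterS; apply; apply: fC.
exact: open_nbhs_nbhs.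
Qed.

(** Freeness holds because some edge is off the axis, and its horizontal part
   detects the angle. For the phase between sections sigma and tau near x, let
   t0 be the angle at x and compare the horizontal parts (a, b) of that edge in
   tau turned by t0 and (A, B) of the same edge in sigma: with complex numbers,
   the remaining angle is the argument of (A + iB) times the conjugate of
   (a + ib), whose real part C is positive at x, hence near x. *)
Lemma V_circle_bundle : circle_bundle (@V_rot R n beta j) (@V_proj R n beta j).
Proof.
split.
- by move=> p; apply: val_inj; rewrite /= rotz0 mulmx1.
- by move=> s t p; apply: val_inj; rewrite /= -mulmxA rotzD addrC.
- move=> t p tp; have [k r0] := V_off_axis p.
  have [e0 e1 _] := mul_rotz (val p) (2 * pi * t) k.
  have E : val p *m rotz (2 * pi * t) = val p by rewrite -[RHS](congr1 val tp).
  move: e0 e1; rewrite E; set a := val p k 0; set b := val p k 1 => e0 e1.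
  apply: cos_eq1_int; apply: (mulfI (lt0r_neq0 r0)); rewrite mulr1 -/a -/b.
  transitivity (a * (a * cos (2 * pi * t) - b * sin (2 * pi * t))
    + b * (a * sin (2 * pi * t) + b * cos (2 * pi * t))); first by ring.
  by rewrite -e0 -e1; ring.
- move=> W sigma tau x oW Wx sW tW.
  have /choice[th thE] : forall z, exists t,
      W z -> val (sigma z) = val (tau z) *m rotz t.
    move=> z; have [Wz|nWz] := pselect (W z); last by exists 0.
    have [ts _] := tW _ Wz; have [ss _] := sW _ Wz.
    have [t tE] := V_proj_eq (etrans ts (esym ss)).
    by exists t.
  pose t0 := th x; have [k r0] := V_off_axis (V_rot t0 (tau x)).
  have rotE z := mul_rotz (val (tau z)) t0 k.
  pose a z := val (tau z) k 0 * cos t0 - val (tau z) k 1 * sin t0.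
  pose b z := val (tau z) k 0 * sin t0 + val (tau z) k 1 * cos t0.
  pose C z := a z * val (sigma z) k 0 + b z * val (sigma z) k 1.
  pose S z := a z * val (sigma z) k 1 - b z * val (sigma z) k 0.
  have CSE z : W z -> C z = (a z ^+ 2 + b z ^+ 2) * cos (th z - t0) /\
      S z = (a z ^+ 2 + b z ^+ 2) * sin (th z - t0).
    move=> Wz; have sE : val (sigma z) = (val (tau z) *m rotz t0) *m rotz (th z - t0).
      by rewrite -mulmxA rotzD addrC subrK thE.
    have [s0 s1 _] := mul_rotz (val (tau z) *m rotz t0) (th z - t0) k.
    move: s0 s1; rewrite -sE; have [-> -> _] := rotE z => s0 s1.
    by rewrite /C /S s0 s1 -/(a z) -/(b z); split; ring.
  have coordC (rho : M -> V) i z : continuous_section (@V_proj R n beta j) W rho ->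
      W z -> {for z, continuous (fun z => val (rho z) k i)}.
    move=> rs /rs[_ rC]; apply: (@continuous_comp _ _ _ rho (fun p : V => val p k i)) => //.
    exact: V_coord_continuous.
  have aC z : W z -> {for z, continuous a}.
    by move=> Wz; apply: continuousB_at; apply: continuousM_at;
      [exact: coordC| exact: cst_continuous|exact: coordC| exact: cst_continuous].
  have bC z : W z -> {for z, continuous b}.
    by move=> Wz; apply: continuousD_at; apply: continuousM_at;
      [exact: coordC| exact: cst_continuous|exact: coordC| exact: cst_continuous].
  have CC z : W z -> {for z, continuous C}.
    by move=> Wz; apply: continuousD_at; apply: continuousM_at;
      [exact: aC| exact: coordC|exact: bC| exact: coordC].
  have SC z : W z -> {for z, continuous S}.
    by move=> Wz; apply: continuousB_at; apply: continuousM_at;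
      [exact: aC| exact: coordC|exact: bC| exact: coordC].
  exists [set z | W z /\ 0 < C z].
  exists (fun z => (t0 + atan (S z / C z)) / (2 * pi)); split.
  + rewrite openE => z [Wz Cz].
    have W' : \forall z' \near z, W z' by exact: open_nbhs_nbhs.
    have C' : \forall z' \near z, 0 < C z'.
      apply: (CC _ Wz [set y | 0 < y]); apply: open_nbhs_nbhs.
      by split => //; exact: open_gt.
    by apply: filterS2 W' C' => z'.
  + split => //; have [-> _] := CSE _ Wx; rewrite subrr cos0 mulr1.
    by move: r0 => /=; have [-> -> _] := rotE x.
  + move=> z [Wz Cz]; split.
      apply: continuousM_at; last exact: cst_continuous.
      apply: continuousD_at; first exact: cst_continuous.
      apply: (@continuous_comp _ _ _ (fun z => S z / C z) atan).
        apply: continuousM_at; first exact: SC.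
        by apply: continuousV; [exact: lt0r_neq0|exact: CC].
      exact: continuous_atan.
    have [CE SE] := CSE _ Wz.
    apply: val_inj; rewrite /= thE//; congr (_ *m _).
    rewrite mulrC divfK ?mulf_neq0// ?gt_eqF ?pi_gt0// CE SE.
    have [||ct st] := @atan_quotient R (a z ^+ 2 + b z ^+ 2) (th z - t0).
    * by rewrite -CE.
    * by rewrite addr_ge0 ?sqr_ge0.
    * by rewrite -rotzD (eq_rotz ct st) rotzD addrC subrK.
Qed.

End PolygonBundle.

(** * Local sections and existence of the Chern class *)

Section FrameSections.
Context (R : realType) (n : nat) (beta : 'I_n -> R) (j : 'I_n).
Hypothesis beta_generic : generic beta.
Hypothesis beta_gt0 : 0 < beta j.

Local Notation M := (polygon_space beta).
Local Notation V := (Vset beta j).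

(** The topology of the polygon space is the quotient topology, so rotation
   invariant continuous functions descend to it. *)
Lemma invariant_continuous (F : 'M[R]_(n, 3) -> R) :
  continuous F -> (forall g v, SO3 g -> F (v *m g) = F v) ->
  continuous (fun z : M => F (val (repr z))).
Proof.
move=> FC Finv.
apply: (@repr_comp_continuous _ _ _ (fun v : closed_polygons beta => F (val v))).
  move=> v; apply: (@continuous_comp _ _ _ (set_val : closed_polygons beta -> _) F).
    exact: initial_continuous.
  exact: FC.
move=> v w /eqP/polygon_classP[g sg ->]; apply/eqP.
by rewrite Finv.
Qed.

Lemma dot_row_continuous i k :
  continuous (fun z : M => dot (row i (val (repr z))) (row k (val (repr z)))).
Proof.
apply: (@invariant_continuous (fun v => dot (row i v) (row k v))).
  have -> : (fun v : 'M[R]_(n, 3) => dot (row i v) (row k v)) =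
      (fun v => v i 0 * v k 0 + v i 1 * v k 1 + v i ord_max * v k ord_max).
    by apply/funext => v; rewrite dot3E !mxE.
  by move=> v; do 2?apply: (@continuousD_at R 'M[R]_(n, 3));
    apply: (@continuousM_at R 'M[R]_(n, 3)); exact: coord_continuous.
by move=> g v [gg _]; rewrite !row_mul dot_orth.
Qed.

Lemma triple_row_continuous i k l : continuous (fun z : M =>
  dot (row i (val (repr z))) (cross (row k (val (repr z))) (row l (val (repr z))))).
Proof.
apply: (@invariant_continuous (fun v => dot (row i v) (cross (row k v) (row l v)))).
  have -> : (fun v : 'M[R]_(n, 3) => dot (row i v) (cross (row k v) (row l v))) =
      (fun v => v i 0 * (v k 1 * v l ord_max - v k ord_max * v l 1)
        + v i 1 * (v k ord_max * v l 0 - v k 0 * v l ord_max)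
        + v i ord_max * (v k 0 * v l 1 - v k 1 * v l 0)).
    by apply/funext => v; rewrite dot3E !mxE.
  by move=> v; do 2?apply: (@continuousD_at R 'M[R]_(n, 3));
    (apply: (@continuousM_at R 'M[R]_(n, 3)); [exact: coord_continuous|]);
    apply: (@continuousB_at R 'M[R]_(n, 3)); apply: (@continuousM_at R 'M[R]_(n, 3));
    exact: coord_continuous.
by move=> g v [gg dg]; rewrite !row_mul triple_mul dg mul1r.
Qed.

Definition transversality k (z : M) :=
  gram (row j (val (repr z))) (row k (val (repr z))).

Lemma transversality_continuous k : continuous (transversality k).
Proof.
have -> : transversality k = (fun z =>
    dot (row j (val (repr z))) (row j (val (repr z)))
      * dot (row k (val (repr z))) (row k (val (repr z)))
    - dot (row j (val (repr z))) (row k (val (repr z)))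
      * dot (row j (val (repr z))) (row k (val (repr z)))) by [].
by move=> z; apply: (@continuousB_at R M); apply: (@continuousM_at R M);
  exact: dot_row_continuous.
Qed.

Lemma frame_section_in k (z : M) : 0 < transversality k z ->
  V (val (repr z) *m frame (row j (val (repr z))) (row k (val (repr z)))).
Proof.
move=> g0; have Pz := set_valP (repr z); split.
  by apply: closed_polygons_orth Pz; have [] := frame_SO3 g0.
by rewrite /= row_mul mul_frame_ez//; have [-> _] := Pz.
Qed.

(** The entries of the turned polygon are built from inner products and triple
   products of its edges, which are functions on the polygon space itself; this is
   what makes the section continuous although [repr] is not. *)
Lemma frame_sections (p0 : V) k : exists tau : M -> V,
  continuous_section (@V_proj R n beta j) [set z | 0 < transversality k z] tau.
Proof.
pose s (z : M) := val (repr z) *m frame (row j (val (repr z))) (row k (val (repr z))).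
pose W := [set z | 0 < transversality k z].
have oW : open W.
  apply: (@open_comp _ _ (transversality k) [set y | 0 < y]); last exact: open_gt.
  by move=> z _; exact: transversality_continuous.
have /choice[tau tauE] : forall z : M, exists p : V, W z -> val p = s z.
  move=> z; have [Wz|nWz] := pselect (W z); last by exists p0.
  by exists (exist (fun v => v \in V) _ (mem_set (frame_section_in Wz))).
have sC z : W z -> {for z, continuous s}.
  move=> Wz; have [gj _] := gram_gt0 Wz.
  have dC i l : {for z, continuous
      (fun z : M => dot (row i (val (repr z))) (row l (val (repr z))))}.
    exact: dot_row_continuous.
  have sqC (f : M -> R) : {for z, continuous f} ->
      {for z, continuous (fun z => Num.sqrt (f z))}.
    by move=> fC; apply: (@continuous_comp _ _ _ f Num.sqrt) => //; exact: sqrt_continuous.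
  have nC : {for z, continuous (fun z : M => enorm (row j (val (repr z))))}.
    exact: sqC (dC j j).
  have rC : {for z, continuous (fun z => Num.sqrt (transversality k z))}.
    by apply: sqC; exact: transversality_continuous.
  have nn : enorm (row j (val (repr z))) != 0 by rewrite gt_eqF// sqrtr_gt0.
  have rn : Num.sqrt (transversality k z) != 0 by rewrite gt_eqF// sqrtr_gt0.
  apply: matrix_continuous_at => i l; elim/ord3_ind: l.
  - have -> : (fun z => s z i 0) = (fun z => (dot (row j (val (repr z))) (row j (val (repr z)))
         * dot (row i (val (repr z))) (row k (val (repr z)))
         - dot (row j (val (repr z))) (row k (val (repr z)))
         * dot (row i (val (repr z))) (row j (val (repr z))))
         / (enorm (row j (val (repr z))) * Num.sqrt (transversality k z))).
      by apply/funext => z'; have [] := mul_frame (val (repr z')) (row j (val (repr z')))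
         (row k (val (repr z'))) i.
    apply: (@continuousM_at R M).
      by apply: (@continuousB_at R M); apply: (@continuousM_at R M).
    by apply: continuousV; [exact: mulf_neq0|exact: (@continuousM_at R M)].
  - have -> : (fun z => s z i 1) = (fun z => dot (row i (val (repr z)))
        (cross (row j (val (repr z))) (row k (val (repr z))))
        / Num.sqrt (transversality k z)).
      by apply/funext => z'; have [] := mul_frame (val (repr z')) (row j (val (repr z')))
         (row k (val (repr z'))) i.
    apply: (@continuousM_at R M); first exact: triple_row_continuous.
    exact: continuousV.
  - have -> : (fun z => s z i ord_max) =
        (fun z => dot (row i (val (repr z))) (row j (val (repr z)))
        / enorm (row j (val (repr z)))).
      by apply/funext => z'; have [] := mul_frame (val (repr z')) (row j (val (repr z')))
         (row k (val (repr z'))) i.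
    by apply: (@continuousM_at R M) => //; exact: continuousV.
exists tau => z Wz; split.
  rewrite -[RHS]reprK; apply/polygon_classP => /=.
  exists (frame (row j (val (repr z))) (row k (val (repr z))))^T.
    have [gg dg] := frame_SO3 Wz.
    by split; rewrite ?trmxK ?det_tr//; exact: mulmx1C.
  have -> : sval (tau z) = s z by exact: tauE.
  by have [gg _] := frame_SO3 Wz; rewrite /s -mulmxA gg mulmx1.
apply: V_continuous_at.
(* Continuity at z only sees a neighbourhood, where tau agrees with s. *)
have E : \forall z' \near z, s z' = val (tau z').
  have W' : \forall z' \near z, W z' by exact: open_nbhs_nbhs.
  by apply: filterS W' => z' /tauE.
have -> : {for z, continuous (fun x => val (tau x))} =
   (val (tau x) @[x --> z] --> s z) :> Prop by rewrite -tauE.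
exact: cvg_trans (near_eq_cvg E) (sC _ Wz).
Qed.

(** The shrinking functions are psi_k = (n + 1) h_k - sum_l h_l with
   h_k = |v_j x v_k|^2. The sum of the h_l is positive; hence h_k > 0 where
   psi_k >= 0, and not all psi_k can be nonpositive, as their total is that sum. *)
Theorem polygon_chern_class_exists :
  exists h, is_chern_class (@V_rot R n beta j) (@V_proj R n beta j) h.
Proof.
have [[z0 _]|M0] := pselect (exists z : M, True); last first.
  by exists 0; apply: chern_class_empty => z; apply: M0; exists z.
have z0P := set_valP (repr z0).
have [k0 g0] := exists_transverse beta_generic beta_gt0 z0P.
pose p0 : V := exist (fun v => v \in V) _
  (mem_set (frame_section_in (g0 : 0 < transversality k0 z0))).
have /choice[tau tauP] := frame_sections p0.
pose psi k z := n.+1%:R * transversality k z - \sum_l transversality l z.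
have sum_gt0 z : 0 < \sum_l transversality l z.
  have [k gk] := exists_transverse beta_generic beta_gt0 (set_valP (repr z)).
  rewrite (bigD1 k)//=; apply: ltr_pwDl => //.
  by apply: sumr_ge0 => l _; exact: gram_ge0.
apply: (@chern_class_exists _ _ _ _ _ (V_circle_bundle beta_generic beta_gt0) 'I_n
  (fun k => [set z | 0 < transversality k z]) tau psi).
- move=> k; apply: (@open_comp _ _ (transversality k) [set y | 0 < y]); last exact: open_gt.
  by move=> z _; exact: transversality_continuous.
- exact: tauP.
- move=> k z; apply: (@continuousB_at R M).
    apply: (@continuousM_at R M); first exact: cst_continuous.
    exact: transversality_continuous.
  apply: continuous_big => [|l _]; last exact: transversality_continuous.
  exact: add_continuous.
- move=> k z; rewrite /psi /= => psi0; have := sum_gt0 z.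
  rewrite -(pmulr_rgt0 (transversality k z) (ltr0Sn R n)); lra.
- move=> z; apply: contrapT => /forallNP psi_le0.
  have := sum_gt0 z; apply/negP; rewrite -leNgt.
  have : \sum_k psi k z <= 0.
    by apply: sumr_le0 => k _; rewrite leNgt; exact/negP.
  rewrite sumrB -mulr_sumr sumr_const card_ord -mulr_natl.
  by rewrite -natr1; lra.
Qed.

End FrameSections.

(** * Restriction to degenerate polygons *)

Section HalfTurn.
Context (R : realType).

(** The rotation by pi about the x-axis if b, and the identity otherwise. *)
Definition half_turn (b : bool) : 'M[R]_3 :=
  diag_mx (\row_i [:: 1; (-1) ^+ b; (-1) ^+ b]`_i).

Lemma half_turn_SO3 b : SO3 (half_turn b).
Proof.
split; last first.
  rewrite det_diag !big_ord_recl big_ord0 !mxE /= mul1r mulr1.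
  by rewrite -expr2 sqrr_sign.
rewrite tr_diag_mx mulmx_diag -diag_const_mx; congr diag_mx; apply/rowP => i.
by rewrite !mxE; elim/ord3_ind: i; rewrite /= ?mulr1// -expr2 sqrr_sign.
Qed.

Lemma ez_half_turn b : ez R *m half_turn b = (-1) ^+ b *: ez R.
Proof.
apply/rowP => i; rewrite mul_mx_diag !mxE.
by elim/ord3_ind: i; rewrite /= ?mul0r ?mulr0 ?mul1r ?mulr1.
Qed.

Lemma rotz_half_turn b t :
  rotz t *m half_turn b = half_turn b *m rotz ((-1) ^+ b * t).
Proof.
rewrite mul_mx_diag mul_diag_mx; apply/matrixP => i k; rewrite !mxE.
by elim/ord3_ind: i; elim/ord3_ind: k; case: b;
  rewrite /= ?expr0 ?expr1 ?mul1r ?mulN1r ?cosN ?sinN; ring.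
Qed.

End HalfTurn.

Section Restriction.
Context (R : realType) (n : nat) (alpha : 'I_n.+2 -> R).
Hypothesis alpha_gt0 : forall i, 0 < alpha i.
Hypothesis alpha_generic : generic alpha.
Hypothesis alpha_neq : alpha ord_max != alpha (penult n).

Lemma alpha_pm_gt0 e k : 0 < alpha_pm alpha e k.
Proof.
have [->|kn] := eqVneq k ord_max.
  by rewrite alpha_pm_max// normr_gt0 signed_sum_neq0.
by rewrite /alpha_pm (negbTE kn).
Qed.

Lemma signed_sum_sign e : signed_sum alpha e =
  (-1) ^+ (signed_sum alpha e < 0)%R * alpha_pm alpha e ord_max.
Proof. by rewrite alpha_pm_max// {1}[signed_sum _ _]realEsign ?num_real. Qed.

(** A signed sum of the short edges is a signed sum of the long ones: the last
   two long edges get the sign of the fused edge, corrected by the sign of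
   [signed_sum], and for [Minus] opposite signs. *)
Lemma generic_alpha_pm e : generic (alpha_pm alpha e).
Proof.
move=> s; pose u := s ord_max (+) (signed_sum alpha e < 0).
pose s' i := match unlift ord_max i with
  | None => u (+) (if e is Minus then true else false)
  | Some k => if k == ord_max then u else s k end.
suff <- : \sum_i (-1) ^+ s' i * alpha i = \sum_k (-1) ^+ s k * alpha_pm alpha e k.
  exact: alpha_generic.
rewrite (bigD1_ord ord_max)//= (bigD1_ord ord_max)//= [RHS](bigD1_ord ord_max)//=.
rewrite addrA; congr (_ + _); last first.
  apply: eq_bigr => k _; rewrite /s' /alpha_pm liftK.
  by rewrite eq_sym (negbTE (neq_lift _ _)).
rewrite /s' unlift_none liftK eqxx -/(penult n).
have -> : alpha_pm alpha e ord_max =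
    (-1) ^+ (signed_sum alpha e < 0)%R * signed_sum alpha e.
  by rewrite [X in _ * X]signed_sum_sign mulrA -expr2 sqrr_sign mul1r.
rewrite mulrA -signr_addb -/u /signed_sum mulrDr addrC; congr (_ + _).
by case: e @u s' => u _; rewrite /= ?addbF// addbT signrN mulNr mulrN.
Qed.

(** Cutting undoes fusing, so the last two edges are read off from the fused one. *)
Lemma collinear_rows e q : closed_polygons alpha q -> collinear e q ->
  row (penult n) q =
    (alpha (penult n) / signed_sum alpha e) *: row ord_max (fuse_mx q) /\
  row ord_max q =
    (signed e (alpha ord_max) / signed_sum alpha e) *: row ord_max (fuse_mx q).
Proof.
move=> Pq cq; have := cut_fuseK alpha_gt0 alpha_neq Pq cq => qE.
by split; rewrite -{1}qE ?row_cut_penult ?row_cut_max.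
Qed.

Lemma over_cut_rotated e i (q : Vset alpha i) z :
  V_proj q = incl_fuse_inv alpha_gt0 alpha_neq e z ->
  exists2 g, SO3 g & val q = cut_mx alpha e (val (repr z)) *m g.
Proof. by move=> /esym/polygon_classP[g sg /= ->]; exists g. Qed.

Lemma fuse_turn_continuous b : continuous
  (fun v : 'M[R]_(n.+2, 3) => fuse_mx v *m half_turn R b).
Proof.
move=> v; apply: (@matrix_continuous_at R 'M[R]_(n.+2, 3)) => k l.
have entryE (w : 'M[R]_(n.+2, 3)) : (fuse_mx w *m half_turn R b) k l =
    (if k == ord_max then w (penult n) l + w ord_max l else w (lift ord_max k) l)
    * [:: 1; (-1) ^+ b; (-1) ^+ b]`_l.
  by rewrite mul_mx_diag !mxE; case: eqP => _; rewrite !mxE.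
have -> : (fun w : 'M[R]_(n.+2, 3) => (fuse_mx w *m half_turn R b) k l) =
    (fun w => (if k == ord_max then w (penult n) l + w ord_max l
               else w (lift ord_max k) l) * [:: 1; (-1) ^+ b; (-1) ^+ b]`_l).
  exact/funext.
apply: (@continuousM_at R 'M[R]_(n.+2, 3)); last exact: cst_continuous.
case: eqP => _; last exact: coord_continuous.
by apply: (@continuousD_at R 'M[R]_(n.+2, 3)); exact: coord_continuous.
Qed.

(** Fusing the last two edges, followed by a half turn if b, maps the part of
   [V_i] over [Dsub e] to [V_k] with degree (-1)^b. *)
Lemma restrict_c1V e i k (b : bool) :
  (forall q, closed_polygons alpha q -> collinear e q ->
    row i q = alpha i *: ez R ->
    row k (fuse_mx q) = (-1) ^+ b *: (alpha_pm alpha e k *: ez R)) ->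
  pullback (incl_fuse_inv alpha_gt0 alpha_neq e) (c1V alpha i) =
  c1V (alpha_pm alpha e) k *~ (-1) ^+ b.
Proof.
move=> rowk.
have chern : is_chern_class (@V_rot R _ alpha i) (@V_proj R _ alpha i) (c1V alpha i).
  by apply: xgetPex; exact: polygon_chern_class_exists.
have bk := alpha_pm_gt0 e k.
have gen := generic_alpha_pm e.
have chern' : is_chern_class (@V_rot R _ (alpha_pm alpha e) k)
    (@V_proj R _ (alpha_pm alpha e) k) (c1V (alpha_pm alpha e) k).
  by apply: xgetPex; exact: polygon_chern_class_exists.
suff pulled : is_chern_class (@V_rot R _ (alpha_pm alpha e) k)
    (@V_proj R _ (alpha_pm alpha e) k)
    (pullback (incl_fuse_inv alpha_gt0 alpha_neq e) (c1V alpha i) *~ (-1) ^+ b).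
  (* The degree is its own inverse, so it may stand on either side. *)
  have -> : c1V (alpha_pm alpha e) k =
      pullback (incl_fuse_inv alpha_gt0 alpha_neq e) (c1V alpha i) *~ (-1) ^+ b.
    exact: (chern_class_unique (V_circle_bundle gen bk) chern' pulled).
  by rewrite -mulrzA -expr2 sqrr_sign mulr1z.
have [[z0 _]|M0] := pselect (exists z : polygon_space (alpha_pm alpha e), True);
    last first.
  by apply: chern_class_empty => z; apply: M0; exists z.
have [k0 g0] := exists_transverse gen bk (set_valP (repr z0)).
pose p0 : Vset (alpha_pm alpha e) k :=
  exist (fun v => v \in Vset (alpha_pm alpha e) k) _
    (mem_set (frame_section_in (g0 : 0 < transversality k k0 z0))).
have tb := half_turn_SO3 R b.
have /choice[F FE] : forall q : Vset alpha i, exists p : Vset (alpha_pm alpha e) k,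
    collinear e (val q) -> val p = fuse_mx (val q) *m half_turn R b.
  move=> q; have [cq|ncq] := pselect (collinear e (val q)); last by exists p0.
  have [Pq qi] := set_valP q.
  suff Vq : Vset (alpha_pm alpha e) k (fuse_mx (val q) *m half_turn R b).
    by exists (exist (fun v => v \in Vset (alpha_pm alpha e) k) _ (mem_set Vq)).
  split; first by apply: closed_polygons_orth (fuse_closed Pq cq); have [] := tb.
  rewrite /= row_mul rowk// -!scalemxAl ez_half_turn !scalerA mulrAC -expr2 sqrr_sign.
  by rewrite mul1r.
have col (q : Vset alpha i) z : V_proj q = incl_fuse_inv alpha_gt0 alpha_neq e z ->
    collinear e (val q).
  move=> /over_cut_rotated[g [gg _] ->]; apply: collinear_orth => //.
  exact: (cut_collinear alpha_gt0 alpha_neq (set_valP (repr z))).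
apply: (chern_class_pullback (F := F) _ _ _ chern).
- move=> q z qz; have [g [gg dg] qE] := over_cut_rotated qz.
  rewrite -[RHS]reprK; apply: esym; apply/polygon_classP => /=.
  exists (g *m half_turn R b).
    have [tt dt] := tb; split; last by rewrite det_mulmx dg dt mulr1.
    by rewrite trmx_mul mulmxA -(mulmxA g) tt mulmx1.
  have -> : sval (F q) = fuse_mx (val q) *m half_turn R b by exact: FE (col _ _ qz).
  by rewrite qE fuse_mxM fuse_cutK// mulmxA.
- move=> t q z qz; apply: val_inj => /=; have cq := col _ _ qz.
  have -> : sval (F q) = fuse_mx (val q) *m half_turn R b by exact: FE.
  have -> : sval (F (V_rot t q)) = fuse_mx (val q *m rotz t) *m half_turn R b.
    by apply: FE; apply: collinear_orth => //; exact: rotz_orth.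
  by rewrite fuse_mxM -!mulmxA rotz_half_turn rmorph_sign.
- move=> sigma z sz sC; apply: V_continuous_at.
  have E : \forall z' \near z,
      fuse_mx (val (sigma z')) *m half_turn R b = val ((F \o sigma) z').
    by apply: filterS sz => z' /col/FE.
  have -> : {for z, continuous (fun x => val ((F \o sigma) x))} =
     (val ((F \o sigma) x) @[x --> z] --> fuse_mx (val (sigma z)) *m half_turn R b) :> Prop.
    by rewrite (nbhs_singleton E).
  apply: cvg_trans (near_eq_cvg E) _.
  apply: (@continuous_comp _ _ _ (fun x => val (sigma x))
    (fun v => fuse_mx v *m half_turn R b)); last exact: fuse_turn_continuous.
  apply: (@continuous_comp _ _ _ sigma (set_val : Vset alpha i -> _)) => //.
  exact: initial_continuous.
Qed.

End Restriction.

Theorem proposition13 (R : realType) (n : nat) (hn : (2 <= n)%N)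
    (alpha : 'I_n.+2 -> R) (alpha_gt0 : forall i, 0 < alpha i)
    (alpha_generic : generic alpha)
    (alpha_neq : alpha ord_max != alpha (penult n)) :
  let c := c1V alpha in
  let c' e := c1V (alpha_pm alpha e) in
  let restr e := pullback (incl_fuse_inv alpha_gt0 alpha_neq e) in
  let sg := sgz (alpha (penult n) - alpha ord_max) in
  [/\ forall (e : pm) (i : 'I_n.+1), (i < n)%N ->
        restr e (c (lift ord_max i)) = c' e i,
      restr Plus (c (penult n)) = c' Plus ord_max,
      restr Minus (c (penult n)) = c' Minus ord_max *~ sg,
      restr Plus (c ord_max) = c' Plus ord_max &
      restr Minus (c ord_max) = c' Minus ord_max *~ - sg].
Proof.
move=> c c' restr sg.
have ss0 e : signed_sum alpha e != 0 by exact: signed_sum_neq0.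
have penultE e : restr e (c (penult n)) =
    c' e ord_max *~ (-1) ^+ (signed_sum alpha e < 0)%R.
  apply: restrict_c1V => // q Pq cq; have [-> _] := collinear_rows alpha_gt0 alpha_neq Pq cq.
  rewrite scalerA -signed_sum_sign//.
  move=> /(congr1 (fun v => (signed_sum alpha e / alpha (penult n)) *: v)).
  rewrite !scalerA mulrA divfK ?lt0r_neq0// divff// scale1r => ->.
  by [].
have maxE e : restr e (c ord_max) =
    c' e ord_max *~ (-1) ^+ (signed e (signed_sum alpha e) < 0)%R.
  apply: restrict_c1V => // q Pq cq; have [_ ->] := collinear_rows alpha_gt0 alpha_neq Pq cq.
  have signE : (-1) ^+ (signed e (signed_sum alpha e) < 0)%R
      * alpha_pm alpha e ord_max = signed e (signed_sum alpha e).
    by rewrite alpha_pm_max// -(signed_norm e) [RHS]realEsign ?num_real.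
  have b0 : signed e (alpha ord_max) != 0.
    by rewrite -normr_eq0 signed_norm normr_eq0 lt0r_neq0.
  rewrite scalerA signE.
  move=> /(congr1 (fun v => (signed_sum alpha e / signed e (alpha ord_max)) *: v)).
  rewrite !scalerA mulrA divfK// divff// scale1r => ->; congr (_ *: _).
  have am := lt0r_neq0 (alpha_gt0 ord_max).
  by clear -am; case: e => /=; rewrite ?invrN ?mulrN ?mulNr divfK.
have sgE (x : R) : x != 0 -> sgz x = (-1) ^+ (x < 0)%R.
  by move=> x0; rewrite sgz_def x0.
split.
- move=> e i ltin.
  have ni : i != ord_max by rewrite -val_eqE /= neq_ltn ltin.
  rewrite /restr (@restrict_c1V _ _ _ _ alpha_generic _ e _ i false) ?expr0 ?mulr1z//.
  move=> q Pq cq; rewrite row_fuse// => ->.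
  by rewrite scale1r /alpha_pm (negbTE ni).
- rewrite penultE ltNge ltW ?expr0 ?mulr1z//.
  by rewrite /signed_sum /= addr_gt0.
- by rewrite penultE -sgE.
- rewrite maxE ltNge ltW ?expr0 ?mulr1z//.
  by rewrite /signed_sum /= addr_gt0.
- by rewrite maxE -sgE ?sgzN//= oppr_eq0.
Qed.
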